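(* Let $G=(V,E)$ be a graph with $|V|=n$, let $\pi$ be a uniformly random ordering of $V$ (with labels $\ell$), and let $Q$ be a $k$-relaxed priority scheduler. Then the Relaxed Queue MIS algorithm run on $G$ and $\pi$ with scheduler $Q$ performs, in expectation, at most $n+\mathrm{poly}(k)$ iterations of its loop; that is, there is a polynomial $p$, independent of $G$ and $n$, such that the expected number of iterations is at most $n+p(k)$.
   Context: Relaxed priority scheduler: a data structure $Q$ holding (task, priority) pairs, with operations ApproxGetMin() (returns some task present in $Q$ and deletes it), Insert(task, priority), and Empty(). Let $\mathrm{rank}(t)$ be the rank, in priority order among all tasks present in $Q$, of the task returned by the $t$-th ApproxGetMin call (rank 1 = highest priority). A task $u$ in $Q$ experiences a priority inversion at an ApproxGetMin call if a task of lower priority than $u$ is returned by that call; $\mathrm{inv}(u)$ is the number of inversions $u$ experiences before being removed. $Q$ is $k$-relaxed ($k\ge 1$) if for every time $t$ and integer $\ell>1$, $\Pr[\mathrm{rank}(t)\ge \ell]\le e^{-\ell/k}$, and for every task $u$ and integer $\ell\ge 1$, $\Pr[\mathrm{inv}(u)\ge \ell]\le e^{-\ell/k}$. Labels: $\ell(u)=i$ if $u$ is the $i$-th vertex of $\pi$; smaller label means higher priority. For an edge $\{u,v\}$ with $\ell(u)<\ell(v)$, $u$ is a predecessor of $v$. Relaxed Queue MIS algorithm: initially $Q$ contains every vertex $v$ with priority $\ell(v)$, and all vertices are marked live. In each iteration: $v\gets Q.\mathrm{ApproxGetMin}()$; if $v$ is marked dead, go to the next iteration; else if $v$ has a predecessor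 that is live and in $Q$, reinsert $v$ into $Q$ with priority $\ell(v)$ and go to the next iteration; otherwise add $v$ to the independent set and mark all neighbors of $v$ dead. The loop stops when $Q$ is empty. Expectation is over both the random permutation and the randomness of $Q$. *)

(* Defs.v *)
From HB Require Import structures.
From mathcomp Require Import all_boot all_order all_algebra all_fingroup.
From mathcomp Require Import all_classical all_reals all_analysis.

Set Implicit Arguments.
Unset Strict Implicit.
Unset Printing Implicit Defensive.

Import Order.TTheory GRing.Theory Num.Theory.

Local Open Scope nat_scope.

Section Queue.
Variable V : finType.

(* A (task, priority) pair; a smaller number is a higher priority. *)
Definition entry : Type := (V * nat)%type.

(* [GetMin x] is a call of ApproxGetMin that returned (and deleted) [x]. *)
Inductive qop : Type := Insert of entry | GetMin of entry.

(* The operations performed on the queue so far, most recent first. *)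
Definition history : Type := seq qop.

Fixpoint contents (h : history) : seq entry :=
  match h with
  | [::] => [::]
  | Insert x :: h' => x :: contents h'
  | GetMin x :: h' => rem x (contents h')
  end.

Definition in_queue (h : history) (u : V) : bool :=
  has (fun y : entry => y.1 == u) (contents h).

Definition rank (h : history) (x : entry) : nat :=
  (count (fun y : entry => y.2 < x.2) (contents h)).+1.

Definition insertions (u : V) (h : history) : nat :=
  count (fun o => if o is Insert y then y.1 == u else false) h.

(* A task may be returned, hence removed, and reinserted later.
   [inversions u j h] counts the inversions experienced by [u] between its
   [j]-th insertion and the removal that follows it: [u] is within that stay
   when it is in the queue and has been inserted [j] times so far. *)
Fixpoint inversions (u : V) (j : nat) (h : history) : nat :=
  match h with
  | [::] => 0
  | Insert _ :: h' => inversions u j h'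
  | GetMin x :: h' =>
      ((insertions u h' == j)
       && has (fun y : entry => (y.1 == u) && (y.2 < x.2)) (contents h'))
      + inversions u j h'
  end.

End Queue.

(* A randomized scheduler: the answer to ApproxGetMin is determined by the
   random seed [w] and by all the operations performed so far. *)
Record scheduler (d : measure_display) (Omega : measurableType d) (V : finType)
  : Type := Scheduler {
  approx_get_min : Omega -> history V -> entry V;
  approx_get_min_in :
    forall w h, contents h != [::] -> approx_get_min w h \in contents h;
  approx_get_min_measurable :
    forall h x, measurable [set w | approx_get_min w h = x]%classic
}.

(* [H w t] is the history of the queue just before call number [t] (counting
   from 0) of ApproxGetMin in an execution with seed [w]; if the queue is then
   empty, the execution is over and that call does not take place. *)
Definition k_relaxed (R : realType) (d : measure_display)
    (Omega : measurableType d) (P : probability Omega R) (V : finType)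
    (Q : scheduler Omega V) (k : R) (H : Omega -> nat -> history V) : Prop :=
  (forall t l : nat, 1 < l ->
     (P [set w | contents (H w t) != [::]
                 /\ (l <= rank (H w t) (approx_get_min Q w (H w t)))%N]%classic
      <= (expR (- (l%:R / k)))%:E)%E)
  /\
  (forall (u : V) (j l : nat), 1 <= l ->
     (P [set w | exists t, (l <= inversions u j (H w t))%N]%classic
      <= (expR (- (l%:R / k)))%:E)%E).

Section MIS.
Variables (d : measure_display) (Omega : measurableType d) (V : finType).
Variables (adj : rel V) (Q : scheduler Omega V).

(* The ordering encoded by [pi] lists [v] at (0-based) position
   [enum_rank (pi v)], so that uniform permutations of [V] encode uniformly
   random orderings of [V]. *)
Definition label (pi : {perm V}) (v : V) : nat := (enum_rank (pi v)).+1.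

Definition predecessor (pi : {perm V}) (u v : V) : bool :=
  adj u v && (label pi u < label pi v).

Record mis_state : Type := MisState {
  hist : history V;
  dead : {set V};
  indep : {set V}
}.

Definition mis_init (pi : {perm V}) : mis_state :=
  MisState [seq Insert (v, label pi v) | v <- enum V] finset.set0 finset.set0.

Definition mis_iteration (pi : {perm V}) (w : Omega) (s : mis_state)
  : mis_state :=
  let x := approx_get_min Q w (hist s) in
  let v := x.1 in
  let h := GetMin x :: hist s in
  if v \in dead s then MisState h (dead s) (indep s)
  else if [exists u, [&& predecessor pi u v, u \notin dead s & in_queue h u]]
  then MisState (Insert (v, label pi v) :: h) (dead s) (indep s)
  else MisState h (dead s :|: [set u | adj v u]) (v |: indep s).

Definition running (s : mis_state) : bool := contents (hist s) != [::].

Definition mis_step (pi : {perm V}) (w : Omega) (s : mis_state) : mis_state :=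
  if running s then mis_iteration pi w s else s.

Definition mis_run (pi : {perm V}) (w : Omega) (t : nat) : mis_state :=
  iter t (mis_step pi w) (mis_init pi).

Definition mis_history (pi : {perm V}) (w : Omega) (t : nat) : history V :=
  hist (mis_run pi w t).

(* Extended-real valued: it is [+oo] if the loop does not terminate. *)
Definition iterations (R : realType) (pi : {perm V}) (w : Omega) : \bar R :=
  (\sum_(0 <= t <oo) ((running (mis_run pi w t))%:R : R)%:E)%E.

Definition expected_iterations (R : realType) (P : probability Omega R)
  : \bar R :=
  (((#|{perm V}|%:R : R)^-1)%:E
   * \sum_(pi : {perm V}) \int[P]_w iterations R pi w)%E.

End MIS.

(* Main.v *)
Require Import Defs.
From mathcomp Require Import all_boot all_order all_algebra all_fingroup.
From mathcomp Require Import all_classical all_reals all_analysis.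
From mathcomp Require Import measurable_realfun zify ring lra.

(** A run that is cut off after finitely many steps makes [#|V|] removals plus
    [b] reinsertions, so only the mean of [b] has to be bounded.

    Suppose that a vertex is reinserted while [m] is the highest-priority vertex
    in the queue.  All vertices before [m] have been removed, so the greedy MIS of
    that prefix has left some adjacent pair alive, and this pair is close after
    [m] as long as few vertices after [m] have been removed early.  A removal after
    [m] is an inversion of [m] during its first stay; later it is an inversion of
    the current top of the queue, which is never reinserted, and only few vertices
    are then ahead of [m] because its rank was small when it was first returned.
    If [L] bounds the ranks and the inversion counts near [m], up to a slack that
    grows with the distance from [m] and with [b], then [m] accounts for at most
    [L^2] reinsertions, and for none unless the window of length [7 * L^6] after
    [m] contains a live adjacent pair.

    For a uniform ordering, exchangeability moves a live pair seen from position
    [i] to the positions [i] and [n - 1]; these events are disjoint for distinct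
    [i], since the vertex at position [i] then kills the last one.  So the number
    of positions whose window contains a live pair has first and second moments
    polynomial in the window length, uniformly in [n].  The exponential tails beat
    every polynomial in [L]; the slack in terms of [b] is absorbed by AM-GM, which
    is where the second moment enters. *)

Set Implicit Arguments.
Unset Strict Implicit.
Unset Printing Implicit Defensive.

Import Order.TTheory GRing.Theory Num.Theory.

Local Open Scope nat_scope.

(** * Deterministic executions of a relaxed queue *)

(** The distance |a - b|: at least one of the two truncated differences is zero. *)
Definition gap (a b : nat) : nat := (a - b) + (b - a).

Section Execution.
Variables (V : finType) (pos : V -> nat).
Hypothesis pos_inj : injective pos.
Hypothesis pos_lt : forall v, pos v < #|V|.

(** The trace of an execution as the queue sees it. A [bad] step is a removal together with its
    reinsertion, so it leaves [Q] unchanged. The graph enters only through [bad_pred] and, later,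
    [bad_window]. *)
Variables (T : nat) (Q : nat -> {set V}) (ret : nat -> V) (bad : nat -> bool).
Variables (ins : nat -> V -> nat) (inv : nat -> V -> nat -> nat).
Hypothesis Q0 : forall v, v \in Q 0.
Hypothesis ins0 : forall v, ins 0 v = 1.
Hypothesis retQ : forall t, t < T -> ret t \in Q t.
Hypothesis QS : forall t v, t < T ->
  (v \in Q t.+1) = (v \in Q t) && (bad t || (v != ret t)).
Hypothesis insS : forall t v, t < T ->
  ins t.+1 v = ins t v + (bad t && (v == ret t)).
Hypothesis invS : forall t v j, t < T ->
  inv t.+1 v j
  = inv t v j + [&& ins t v == j, v \in Q t & pos v < pos (ret t)].
Hypothesis bad_pred : forall t, t < T -> bad t ->
  exists2 u, u \in Q t & pos u < pos (ret t).

Definition nbad (t : nat) : nat := \sum_(i < t) bad i.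
Definition miss (t : nat) (m : V) : nat :=
  #|[pred v | (v \notin Q t) && (pos m < pos v)]|.
Definition low (t : nat) (m : V) : nat :=
  #|[pred v | (v \in Q t) && (pos v < pos m)]|.
Definition top (t : nat) (x : V) : bool :=
  (x \in Q t) && [forall y, (y \in Q t) ==> (pos x <= pos y)].

Lemma topP t x :
  reflect (x \in Q t /\ forall y, y \in Q t -> pos x <= pos y) (top t x).
Proof.
apply: (iffP andP) => -[xQ xmin]; split=> //.
- by move=> y yQ; move/forallP/(_ y)/implyP: xmin; apply.
- by apply/forallP => y; apply/implyP; apply: xmin.
Qed.

Lemma top_exists t y : y \in Q t -> exists2 x, top t x & pos x <= pos y.
Proof.
move=> yQ; case: (arg_minnP pos yQ) => x xQ xmin.
by exists x; [apply/topP; split | apply: xmin].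
Qed.

Lemma top_uniq t x y : top t x -> top t y -> x = y.
Proof.
move=> /topP[xQ xmin] /topP[yQ ymin]; apply: pos_inj; apply/eqP.
by rewrite eqn_leq xmin ?ymin.
Qed.

Lemma nbadS t : nbad t.+1 = nbad t + bad t.
Proof. by rewrite /nbad big_ord_recr. Qed.

Lemma leq_nbad s t : s <= t -> nbad s <= nbad t.
Proof.
move=> /subnK <-; elim: (t - s) => // i; rewrite addSn nbadS; lia.
Qed.

Lemma leq_inv s t v j : s <= t -> t <= T -> inv s v j <= inv t v j.
Proof.
move=> /subnK <-; elim: (t - s) => // i IH; rewrite addSn => lt_T.
by rewrite invS //; apply: leq_trans (leq_addr _ _); apply: IH; apply: ltnW.
Qed.

Lemma leq_ins s t v : s <= t -> t <= T -> ins s v <= ins t v.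
Proof.
move=> /subnK <-; elim: (t - s) => // i IH; rewrite addSn => lt_T.
by rewrite insS //; apply: leq_trans (leq_addr _ _); apply: IH; apply: ltnW.
Qed.

Lemma ins_gt0 t v : t <= T -> 0 < ins t v.
Proof. by move=> tT; apply: leq_trans (leq_ins _ (leq0n t) tT); rewrite ins0. Qed.

Lemma ins_le_nbad t v : t <= T -> ins t v <= (nbad t).+1.
Proof.
elim: t => [|t IH] tT; first by rewrite ins0.
rewrite insS // nbadS; have := IH (ltnW tT).
by case: (bad t); case: (v == ret t) => /=; lia.
Qed.

Lemma subQ s t v : s <= t -> t <= T -> v \in Q t -> v \in Q s.
Proof.
move=> /subnK <-; elim: (t - s) => // i IH; rewrite addSn => lt_T.
by rewrite QS // => /andP[vQ _]; apply: IH => //; apply: ltnW.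
Qed.

Lemma removed_card t : t <= T -> #|[predC (Q t)]| + nbad t = t.
Proof.
elim: t => [|t IH] tT.
  rewrite /nbad big_ord0 addn0; apply: eq_card0 => v.
  by rewrite !inE Q0.
rewrite nbadS; have {IH} := IH (ltnW tT).
case bt: (bad t).
  have -> : #|[predC (Q t.+1)]| = #|[predC (Q t)]|.
    by apply: eq_card => v; rewrite !inE QS // bt andbT.
  lia.
have -> : #|[predC (Q t.+1)]| = #|[predC (Q t)]|.+1.
  rewrite (cardD1 (ret t)) !inE QS // eqxx bt andbF /= add1n; congr _.+1.
  apply: eq_card => v; rewrite !inE QS // bt /=.
  by case: eqP => [->|_]; rewrite ?retQ //= ?andbT.
lia.
Qed.

Lemma steps_le : T <= #|V| + nbad T.
Proof.
by rewrite -{1}(removed_card (leqnn T)) leq_add2r max_card.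
Qed.

Lemma nbad_le_T : nbad T <= T.
Proof. by rewrite -{2}(removed_card (leqnn T)) leq_addl. Qed.

(** An injection of [V] into ['I_#|V|] is onto, so every position below [pos m] is occupied. *)
Lemma card_pos_lt m : #|[pred v | pos v < pos m]| = pos m.
Proof.
pose f v : 'I_#|V| := Ordinal (pos_lt v).
have f_inj : injective f by move=> u v /(congr1 val) /pos_inj.
have f_onto y : y \in codom f by apply: inj_card_onto; rewrite ?card_ord.
rewrite -(fintype.card_image f_inj) -[RHS]card_ord.
have le_m : pos m <= #|V| by exact: ltnW (pos_lt m).
have w_inj : injective (widen_ord le_m) 
  by move=> i j ij; apply: val_inj; exact: (congr1 val ij).
rewrite -(fintype.card_image w_inj).
apply: eq_card => i; apply/fintype.imageP/fintype.imageP => [[v vm ->]|[j _ ->]].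
  by exists (Ordinal vm) => //; apply: val_inj.
have /codomP[v fv] := f_onto (widen_ord le_m j).
exists v => //; rewrite inE; have := congr1 val fv => /= <-; exact: ltn_ord.
Qed.

Lemma removed_split t m : m \in Q t ->
  #|[predC (Q t)]| + low t m = pos m + miss t m.
Proof.
move=> mQ; rewrite -{1}(card_pos_lt m) /low /miss.
rewrite -(cardID (Q t) [pred v | pos v < pos m]).
rewrite -(cardID [pred v | pos v < pos m] [predC (Q t)]).
have -> : #|[predI [pred v | pos v < pos m] & Q t]|
         = #|[pred v | (v \in Q t) && (pos v < pos m)]|.
  by apply: eq_card => v; rewrite !inE andbC.
have -> : #|[predI [predC Q t] & [pred v | pos v < pos m]]|
         = #|[predD [pred v | pos v < pos m] & Q t]|.
  by apply: eq_card => v; rewrite !inE andbC.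
have -> : #|[predD [predC Q t] & [pred v | pos v < pos m]]|
         = #|[pred v | (v \notin Q t) && (pos m < pos v)]|.
  apply: eq_card => v; rewrite !inE andbC -leqNgt leq_eqVlt.
  by case: eqP => [/pos_inj <-|//]; rewrite mQ.
lia.
Qed.

(** The balance between time and position on which the estimates rest. Of the [pos m] vertices
    before [m] all but [low t m] are gone, [miss t m] later ones are gone, and every remaining step
    was bad. *)
Lemma removed_at t m : t <= T -> m \in Q t ->
  t + low t m = pos m + miss t m + nbad t.
Proof. by move=> tT mQ; have := removed_split mQ; have := removed_card tT; lia. Qed.

Lemma top_low t m : top t m -> low t m = 0.
Proof.
move=> /topP[_ mmin]; apply: eq_card0 => v; rewrite !inE.
by apply/negP => /andP[/mmin]; lia.
Qed.

Lemma missS t m : t < T ->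
  miss t.+1 m <= miss t m + (~~ bad t && (pos m < pos (ret t))).
Proof.
move=> tT; case bt: (bad t).
  rewrite addn0; apply: subset_leq_card; apply/fintype.subsetP => v.
  by rewrite !inE QS // bt andbT.
case: ltnP => /= mr.
  rewrite /miss (cardD1 (ret t)) addnC; apply: leq_add; last exact: leq_b1.
  apply: subset_leq_card; apply/fintype.subsetP => v; rewrite !inE QS // bt /=.
  by case: eqP => //= _; rewrite andbT.
rewrite addn0; apply: subset_leq_card; apply/fintype.subsetP => v; rewrite !inE QS // bt /=.
case: eqP => [->|_]; last by rewrite andbT.
by rewrite ltnNge mr andbF.
Qed.

(** Until [m] is first reinserted, each removal of a later vertex is an inversion of its first
    stay. *)
Lemma miss_first_stay t m : t <= T -> m \in Q t -> ins t m = 1 ->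
  miss t m <= inv t m 1.
Proof.
elim: t => [|t IH] tT mQ im.
  by rewrite /miss eq_card0 // => v; rewrite !inE Q0.
have mQt : m \in Q t by apply: subQ mQ.
have imt : ins t m = 1.
  by have := ins_gt0 m (ltnW tT); have := leq_ins m (leqnSn t) tT; lia.
have := IH (ltnW tT) mQt imt; have := missS m tT.
by rewrite invS // imt mQt /=; case: (bad t) => /=; lia.
Qed.

(** The same count over all stays of [m], of which there are at most one more than the bad steps. *)
Lemma miss_all_stays t m : t <= T -> m \in Q t ->
  miss t m <= \sum_(j < (nbad T).+1) inv t m j.+1.
Proof.
elim: t => [|t IH] tT mQ.
  by rewrite /miss eq_card0 // => v; rewrite !inE Q0.
have mQt : m \in Q t by apply: subQ mQ.
have {IH} := IH (ltnW tT) mQt; have := missS m tT.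
under [X in _ -> _ -> _ <= X]eq_bigr do rewrite invS // mQt /=.
rewrite big_split /=.
have i_gt0 := ins_gt0 m (ltnW tT).
have i_le : (ins t m).-1 < (nbad T).+1.
  have := ins_le_nbad m (ltnW tT); have := leq_nbad (ltnW tT); lia.
rewrite [X in _ -> _ -> _ <= _ + X](bigD1 (Ordinal i_le)) //=.
rewrite prednK // eqxx /=; case: (bad t) => /=; lia.
Qed.

(** A bad return needs a smaller vertex in the queue, and [Q] only shrinks. A vertex once on top is
    therefore never reinserted, and its current stay is its last. *)
Lemma top_ins s t x : s <= t -> t <= T -> top s x -> ins t x = ins s x.
Proof.
move=> st tT /topP[xQ xmin]; move: tT; rewrite -(subnK st).
elim: (t - s) => // i IH; rewrite addSn => lt_T.
rewrite insS // (IH (ltnW lt_T)); case b: (bad _) => /=; last by rewrite addn0.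
case: eqP => [xr|]; last by rewrite addn0.
have [u uQ] := bad_pred lt_T b; rewrite -xr.
have /xmin : u \in Q s by apply: subQ uQ; [exact: leq_addl | exact: ltnW].
lia.
Qed.

(* Every removal above [m] after time [s] is an inversion of the element then on
   top, which is in its final stay. *)
Lemma miss_after s t m : s <= t -> t <= T -> m \in Q t ->
  miss t m <= miss s m
    + \sum_(x | (x \in Q s) && (pos x <= pos m)) inv t x (ins T x).
Proof.
move=> st tT; move: tT; rewrite -{1 2 3 4}(subnK st).
elim: (t - s) => [|i IH]; first by move=> _ _; apply: leq_addr.
rewrite addSn => lt_T mQ.
have mQt : m \in Q (i + s) by apply: subQ mQ.
have {IH} IH := IH (ltnW lt_T) mQt.
apply: leq_trans (missS m lt_T) _.
apply: leq_trans (leq_add IH (leqnn _)) _; rewrite -addnA leq_add2l.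
have [x topx xm] := top_exists mQt.
have [xQ _] := topP _ _ topx.
have xQs : x \in Q s by apply: subQ xQ; [exact: leq_addl | exact: ltnW].
rewrite (bigD1 x) ?xQs //= [X in _ <= X](bigD1 x) ?xQs //=.
rewrite -addnA [X in _ + X]addnC addnA; apply: leq_add; last first.
  by apply: leq_sum => y _; apply: leq_inv.
rewrite invS // (top_ins (ltnW lt_T) (leqnn T) topx) eqxx xQ /= leq_add2l.
by case: (bad _) => //=; lia.
Qed.

(** A bad return while [m] is on top returns a later vertex, hence inverts [m] during its final
    stay. *)
Lemma bad_top_le m :
  \sum_(t < T) (bad t && top t m) <= inv T m (ins T m).
Proof.
suff H t : t <= T -> \sum_(i < t) (bad i && top i m) <= inv t m (ins T m) by exact: H.
elim: t => [|t IH] tT; first by rewrite big_ord0.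
rewrite big_ord_recr /= invS //; apply: leq_add; first exact: IH (ltnW tT).
case b: (bad t) => //=; case topm: (top t m) => //.
have [mQ mmin] := topP _ _ topm.
rewrite (top_ins (ltnW tT) (leqnn T) topm) eqxx mQ /=.
by have [u /mmin] := bad_pred tT b; lia.
Qed.

Lemma first_bad_return t m : t <= T -> 1 < ins t m ->
  exists s, [/\ s < t, ret s = m, bad s & ins s m = 1].
Proof.
elim: t => [|t IH] tT; first by rewrite ins0.
case: (ltnP 1 (ins t m)) => [/(IH (ltnW tT)) [s [st ? ? ?]] _|le1].
  by exists s; split=> //; apply: ltnW.
have := ins_gt0 m (ltnW tT); rewrite insS //.
case b: (bad t); case: eqP => [mr|_] /=; try lia.
move=> i_gt0 _; exists t; split=> //; lia.
Qed.

(** * Consequences of rank and inversion bounds at a fixed level [L] *)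

Section Level.
Variables (p L : nat) (m : V).
Hypothesis p_ge : 36 <= p.
Hypothesis L_gt0 : 0 < L.
(** This says that the rank is at most L times the [p]-th root of the distance plus one; [inv_le] is
    similar. Raising to the power [p] keeps everything in the natural numbers. *)
Hypothesis rank_le : forall t, t < T ->
  (low t (ret t)).+1 ^ p <= L ^ p * (gap t (pos m)).+1.
Hypothesis inv_le : forall x j, pos x <= pos m -> j <= T.+1 ->
  inv T x j ^ p <= L ^ p * (pos m - pos x).+1 * j.+1.
Hypothesis nbad_le : nbad T + 2 <= L ^ p.

Let p_gt0 : 0 < p. Proof. lia. Qed.

Lemma inv_level x j : pos x <= pos m -> j <= (nbad T).+1 ->
  inv T x j ^ p <= L ^ (2 * p) * (pos m - pos x).+1.
Proof.
move=> xm jb; have jT : j <= T.+1 by have := nbad_le_T; lia.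
apply: leq_trans (inv_le xm jT) _.
rewrite mul2n -addnn expnD mulnAC.
have jL : j.+1 <= L ^ p by apply: leq_trans nbad_le; rewrite addn2 ltnS.
by rewrite leq_mul2r leq_mul2l jL !orbT.
Qed.

Lemma expL_gt0 i : 0 < L ^ i. Proof. by rewrite expn_gt0 L_gt0. Qed.

(** Extracts a [p]-th root; a constant up to 2^p costs only a factor 2. *)
Lemma leq_root a c i : a ^ p <= c * L ^ (i * p) -> c <= 2 ^ p -> a <= 2 * L ^ i.
Proof.
move=> ap cp; rewrite -(leq_exp2r _ _ p_gt0); apply: leq_trans ap _.
by rewrite expnMn -expnM leq_mul2r cp orbT.
Qed.

Lemma inv_top_level j : j <= (nbad T).+1 -> inv T m j <= L ^ 2.
Proof.
move=> jb; rewrite -(leq_exp2r _ _ p_gt0) -expnM.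
by have := inv_level (leqnn _) jb; rewrite subnn muln1.
Qed.

Lemma leq_const_exp c : c <= 2 ^ 6 -> c <= 2 ^ p.
Proof. by move=> cp; apply: leq_trans cp _; rewrite leq_exp2l //; lia. Qed.

Lemma leq_expL i j : i <= j -> L ^ i <= L ^ j.
Proof. by move=> ij; rewrite leq_pexp2l. Qed.

(** The rank [r] enters its own bound: by the balance equation the gap is at most r + 2 L^p, so r^p
    <= L^p r + 2 L^(2p). If r > 2 L^2, each summand is at most a quarter of r^p, which is absurd. *)
Lemma rank_first_bad s : s < T -> ret s = m -> bad s -> ins s m = 1 ->
  (low s m).+1 <= 2 * L ^ 2.
Proof.
move=> sT rs bs is1; have mQ : m \in Q s by rewrite -rs retQ.
have := rank_le sT; rewrite rs; set r := (low s m).+1 => r_le.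
have miss_le : miss s m <= L ^ 2.
  apply: leq_trans (miss_first_stay (ltnW sT) mQ is1) _.
  by apply: leq_trans (leq_inv _ _ (ltnW sT) (leqnn T)) _; apply: inv_top_level.
have gap_le : (gap s (pos m)).+1 <= r + 2 * L ^ p.
  have := removed_at (ltnW sT) mQ; have := leq_nbad (ltnW sT).
  have : L ^ 2 <= L ^ p by apply: leq_expL; lia.
  rewrite /gap /r; lia.
have {gap_le r_le} r_le : r ^ p <= L ^ p * r + 2 * L ^ (2 * p).
  apply: leq_trans r_le _; apply: leq_trans (leq_mul (leqnn _) gap_le) _.
  by rewrite mulnDr leq_add2l mulnCA leq_mul2l -expnD addnn mul2n leqnn orbT.
rewrite leqNgt; apply/negP => r_gt.
have r_ge : 2 * L ^ 2 <= r by exact: ltnW.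
have A : 4 * (L ^ p * r) <= r ^ p.
  rewrite -[X in _ <= r ^ X](prednK p_gt0) expnSr mulnA leq_mul2r; apply/orP; right.
  apply: (@leq_trans ((2 * L ^ 2) ^ p.-1)); last by rewrite leq_exp2r; lia.
  rewrite expnMn -expnM; apply: leq_mul; last by apply: leq_expL; lia.
  by rewrite -[4]/(2 ^ 2) leq_exp2l //; lia.
have B : 8 * L ^ (2 * p) <= r ^ p.
  apply: (@leq_trans ((2 * L ^ 2) ^ p)); last by rewrite leq_exp2r.
  rewrite expnMn -expnM leq_mul2r -[8]/(2 ^ 3) leq_exp2l //.
  by apply/orP; right; lia.
have := expL_gt0 (2 * p); lia.
Qed.

(** Subtracting the balance equations of [e] and [m] bounds their distance by [miss s e + low s m].
    With [I] the largest inversion count of [e] over its stays, [miss s e] is at most L^p I, while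
    I^p is at most L^(2p) times the distance plus one. Hence I^(p-1) <= 3 L^(3p), which forces I <=
    2 L^4. *)
Lemma top_first_bad s : s < T -> ret s = m -> bad s -> ins s m = 1 ->
  forall e, top s e -> (pos m - pos e).+1 <= 5 * L ^ (p + 4).
Proof.
move=> sT rs bs is1 e tope; have [eQ emin] := topP _ _ tope.
have mQ : m \in Q s by rewrite -rs retQ.
have em : pos e <= pos m by exact: emin.
have r_le := rank_first_bad sT rs bs is1.
pose I := \max_(j < (nbad T).+1) inv T e j.+1.
have dist_le : pos m - pos e <= (nbad T).+1 * I + low s m.
  have me : miss s e <= (nbad T).+1 * I.
    apply: leq_trans (miss_all_stays (ltnW sT) eQ) _.
    rewrite -[X in X * I](card_ord (nbad T).+1) -sum_nat_const.
    apply: leq_sum => j _; apply: leq_trans (leq_inv _ _ (ltnW sT) (leqnn T)) _.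
    exact: (@bigop.leq_bigmax _ (fun j : 'I_(nbad T).+1 => inv T e j.+1) j).
  have := removed_at (ltnW sT) eQ; have := removed_at (ltnW sT) mQ.
  rewrite (top_low tope); lia.
have dist_le' : (pos m - pos e).+1 <= L ^ p * I + 2 * L ^ p.
  have : (nbad T).+1 * I <= L ^ p * I by rewrite leq_mul2r; apply/orP; right; lia.
  have : L ^ 2 <= L ^ p by apply: leq_expL; lia.
  lia.
have I_le : I ^ p <= L ^ (2 * p) * (pos m - pos e).+1.
  have [j ->] : {j : 'I_(nbad T).+1 | I = inv T e j.+1}.
    by apply: bigop.eq_bigmax; rewrite card_ord.
  by apply: inv_level => //; apply: ltn_ord.
have {I_le} I_le : I <= 2 * L ^ 4.
  have [->//|I_gt0] := posnP I.
  have : I ^ p <= 3 * L ^ (3 * p) * I.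
    apply: leq_trans I_le _; apply: leq_trans (leq_mul (leqnn _) dist_le') _.
    have -> : 3 * L ^ (3 * p) * I = L ^ (2 * p) * (L ^ p * (3 * I)).
      by rewrite [3 * p]mulSn expnD; ring.
    rewrite leq_mul2l [2 * L ^ p]mulnC -mulnDr leq_mul2l; apply/orP; right.
    by apply/orP; right; lia.
  rewrite -[X in I ^ X](prednK p_gt0) expnSr leq_mul2r gtn_eqF //= => I_le'.
  have p1 : 0 < p.-1 by lia.
  rewrite -(leq_exp2r _ _ p1); apply: leq_trans I_le' _.
  rewrite expnMn -expnM; apply: leq_mul; last by apply: leq_expL; lia.
  by apply: (@leq_trans (2 ^ 2)) => //; rewrite leq_exp2l //; lia.
apply: leq_trans dist_le' _.
rewrite expnD [2 * L ^ p]mulnC -mulnDr mulnCA leq_mul2l; apply/orP; right.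
by have := expL_gt0 4; lia.
Qed.

(** Such an [x] lies between the top of the queue and [m], so its distance to [m] is already
    controlled and its slack is absorbed by one more power L^p. *)
Lemma inv_below_first_bad s x j : s < T -> ret s = m -> bad s -> ins s m = 1 ->
  x \in Q s -> pos x <= pos m -> j <= (nbad T).+1 -> inv T x j <= 2 * L ^ 4.
Proof.
move=> sT rs bs is1 xQ xm jb; have [e tope ex] := top_exists xQ.
apply: (@leq_root _ 5); last exact: leq_const_exp.
apply: leq_trans (inv_level xm jb) _.
apply: (@leq_trans (L ^ (2 * p) * (5 * L ^ (p + 4)))).
  rewrite leq_mul2l; apply/orP; right.
  by apply: leq_trans (top_first_bad sT rs bs is1 tope); rewrite ltnS leq_sub2l.
by rewrite mulnCA leq_mul2l -expnD; apply/orP; right; apply: leq_expL; lia.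
Qed.

(** During the first stay [miss] is at most L^2. After the first bad return, [miss_after] adds the
    inversions of at most 2 L^2 vertices, each at most 2 L^4. *)
Lemma miss_level t : t <= T -> m \in Q t -> miss t m <= 5 * L ^ 6.
Proof.
move=> tT mQ; have L26 : L ^ 2 <= L ^ 6 by exact: leq_expL.
have first_le s : s <= T -> m \in Q s -> ins s m = 1 -> miss s m <= L ^ 2.
  move=> sT sQ is1; apply: leq_trans (miss_first_stay sT sQ is1) _.
  by apply: leq_trans (leq_inv _ _ sT (leqnn T)) _; apply: inv_top_level.
have [it|it] := leqP (ins t m) 1.
  have /first_le : ins t m = 1 by have := ins_gt0 m tT; lia.
  by move/(_ tT mQ); lia.
have [s [st rs bs is1]] := first_bad_return tT it.
have sT : s < T by exact: leq_trans tT.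
have msQ : m \in Q s by rewrite -rs retQ.
apply: leq_trans (miss_after (ltnW st) tT mQ) _.
have r_le := rank_first_bad sT rs bs is1.
have : \sum_(x | (x \in Q s) && (pos x <= pos m)) inv t x (ins T x)
    <= (low s m).+1 * (2 * L ^ 4).
  have -> : (low s m).+1 = #|[pred x | (x \in Q s) && (pos x <= pos m)]|.
    rewrite [RHS](cardD1 m) inE msQ leqnn add1n; congr _.+1.
    apply: eq_card => x; rewrite !inE [pos x <= _]leq_eqVlt.
    have [->|xm] := eqVneq x m; first by rewrite ltnn andbF.
    by case: eqP => // /pos_inj /eqP; rewrite (negPf xm).
  rewrite -sum_nat_const; apply: leq_sum => x /andP[xQ xm].
  apply: leq_trans (leq_inv _ _ tT (leqnn T)) _.
  by apply: (inv_below_first_bad sT) => //; apply: ins_le_nbad.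
have : (low s m).+1 * (2 * L ^ 4) <= (2 * L ^ 2) * (2 * L ^ 4) by rewrite leq_mul2r r_le orbT.
have -> : (2 * L ^ 2) * (2 * L ^ 4) = 4 * L ^ 6.
  by rewrite mulnACA -expnD.
have := first_le s (ltnW sT) msQ is1; lia.
Qed.

(** The balance equations of [m] and of the returned vertex give a distance of at most [miss t m]
    plus the number of vertices ahead of the returned one: 5 L^6 + 2 L^2. *)
Lemma top_window t : t < T -> top t m -> pos (ret t) <= pos m + 7 * L ^ 6.
Proof.
move=> tT topm; have [mQ _] := topP _ _ topm.
have miss_le := miss_level (ltnW tT) mQ.
have tm := removed_at (ltnW tT) mQ; rewrite (top_low topm) in tm.
have tr := removed_at (ltnW tT) (retQ tT).
have : (low t (ret t)).+1 <= 2 * L ^ 2.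
  apply: (@leq_root _ 6); last exact: leq_const_exp.
  apply: leq_trans (rank_le tT) _; rewrite mul2n -addnn expnD mulnCA leq_mul2l.
  apply/orP; right; have := leq_nbad (ltnW tT); rewrite /gap.
  have : L ^ 6 <= L ^ p by apply: leq_expL; lia.
  lia.
have : L ^ 2 <= L ^ 6 by exact: leq_expL.
lia.
Qed.

Lemma bad_top_level : \sum_(t < T) (bad t && top t m) <= L ^ 2.
Proof. by apply: leq_trans (bad_top_le m) _; apply/inv_top_level/ins_le_nbad. Qed.

End Level.

(** * Charging the reinsertions to the vertices on top *)

Variables (p : nat) (z : nat -> V -> bool).
Hypothesis p_ge : 36 <= p.
Hypothesis inv0 : forall v j, inv 0 v j = 0.
Hypothesis bad_window : forall t m w, t < T -> bad t -> top t m ->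
  pos (ret t) <= pos m + w -> z w m.

(* The factors growing with the distance to [m] and with [j] make the failure
   probabilities summable over [t], [x] and [j], uniformly in [T] and [#|V|]. *)
Definition good (m : V) (L : nat) : bool :=
  [forall t : 'I_T, (low t (ret t)).+1 ^ p <= L ^ p * (gap t (pos m)).+1]
  && [forall x, forall j : 'I_T.+2, (pos x <= pos m) ==>
       (inv T x j ^ p <= L ^ p * (pos m - pos x).+1 * j.+1)].

Definition cost (L : nat) (m : V) : nat := L ^ 2 * z (7 * L ^ 6) m.

Lemma bad_top_cost m L : 0 < L -> nbad T + 2 <= L ^ p -> good m L ->
  \sum_(t < T) (bad t && top t m) <= cost L m.
Proof.
move=> L_gt0 bL /andP[/forallP rank_le /forallP inv_le].
have rank_le' t : t < T -> (low t (ret t)).+1 ^ p <= L ^ p * (gap t (pos m)).+1.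
  by move=> tT; apply: (rank_le (Ordinal tT)).
have inv_le' x j : pos x <= pos m -> j <= T.+1 ->
    inv T x j ^ p <= L ^ p * (pos m - pos x).+1 * j.+1.
  by move=> xm jT; have /forallP/(_ (Ordinal (jT : j < T.+2)))/implyP := inv_le x; apply.
rewrite /cost; case zm: (z _ m).
  by rewrite muln1; apply: (@bad_top_level p).
rewrite big1 // => t _; case: andP => // -[bt tt].
by move: zm; rewrite (bad_window (ltn_ord t) bt tt) //; apply: (@top_window p).
Qed.

(** At every step exactly one vertex is on top, so the charges partition the bad steps. *)
Lemma nbad_top : nbad T = \sum_m \sum_(t < T) (bad t && top t m).
Proof.
rewrite exchange_big; apply: eq_bigr => t _ /=.
have [m topm _] := top_exists (retQ (ltn_ord t)).
rewrite (bigD1 m) //= topm andbT big1 ?addn0 // => x xm.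
case: (bad t) => //=; case topx: (top t x) => //.
by rewrite (top_uniq topx topm) eqxx in xm.
Qed.

Lemma inv_le_time t v j : t <= T -> inv t v j <= t.
Proof.
elim: t => [|t IH] tT; first by rewrite inv0.
by rewrite invS // -[t.+1]addn1; apply: leq_add; [exact: IH (ltnW tT) | exact: leq_b1].
Qed.

Lemma good_le m L L' : L <= L' -> good m L -> good m L'.
Proof.
move=> LL; have p_gt0 : 0 < p by lia.
have LLp : L ^ p <= L' ^ p by rewrite leq_exp2r.
case/andP => /forallP rl /forallP il; apply/andP; split.
  by apply/forallP => t; apply: leq_trans (rl t) _; rewrite leq_mul2r LLp orbT.
apply/forallP => x; apply/forallP => j; apply/implyP => xm.
move/forallP/(_ j)/implyP/(_ xm): (il x) => /leq_trans; apply.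
by rewrite !leq_mul2r LLp !orbT.
Qed.

(** Ranks never exceed [#|V|] and inversion counts never exceed [T], so a least good level exists
    and is bounded. *)
Lemma good_max m : good m (#|V| + T).+1.
Proof.
have p_gt0 : 0 < p by lia.
apply/andP; split.
  apply/forallP => t; rewrite -[X in X <= _]muln1; apply: leq_mul => //.
  rewrite leq_exp2r // ltnS; apply: leq_trans (leq_addr _ _); exact: max_card.
apply/forallP => x; apply/forallP => j; apply/implyP => _.
rewrite -mulnA -[X in X <= _]muln1; apply: leq_mul => //.
rewrite leq_exp2r //; apply: leq_trans (inv_le_time _ _ (leqnn T)) _; lia.
Qed.

(** Each [m] is charged at the larger of [beta] and its least good level. The level [beta] pays for
    the typical case; a higher level is paid for by the failure just below it. *)
Lemma nbad_le_cost beta : 0 < beta -> nbad T + 2 <= beta ^ p ->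
  nbad T <= \sum_m (cost 1 m + \sum_(l < #|V| + T) ~~ good m l.+1 * cost l.+2 m)
            + \sum_m cost beta m.
Proof.
move=> beta_gt0 bb; rewrite nbad_top -big_split /=; apply: leq_sum => m _.
have ex_good : exists l, good m l.+1 by exists (#|V| + T); apply: good_max.
case: (ex_minnP ex_good) => l gl lmin.
have l_le : l <= #|V| + T by apply/lmin/good_max.
have [lb|bl] := leqP l.+1 beta.
  by apply: leq_trans (bad_top_cost beta_gt0 bb (good_le lb gl)) (leq_addl _ _).
apply: leq_trans (leq_addr _ _).
have bl' : nbad T + 2 <= l.+1 ^ p.
  by apply: leq_trans bb _; rewrite leq_exp2r; lia.
apply: leq_trans (bad_top_cost _ bl' gl) _ => //.
(* Least good level 1 is covered by [cost 1 m]; least good level [l.+2] by the summand [l], since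
   level [l.+1] fails. *)
case: l gl lmin l_le {bl bl'} => [|l] gl lmin l_le; first exact: leq_addr.
rewrite (bigD1 (Ordinal l_le)) //=.
have -> : ~~ good m l.+1 by apply/negP => /lmin; rewrite ltnn.
lia.
Qed.

Lemma not_good_le m L : ~~ good m L <=
  \sum_(t < T) (L ^ p * (gap t (pos m)).+1 < (low t (ret t)).+1 ^ p)
  + \sum_(x | pos x <= pos m) \sum_(j < T.+2)
      (L ^ p * (pos m - pos x).+1 * j.+1 < inv T x j ^ p).
Proof.
case g: (good m L) => //; move/negbT: g; rewrite negb_and => /orP[] /forallPn[].
  move=> t; rewrite -ltnNge => vt; rewrite (bigD1 t) //= vt.
  by rewrite -!addnA.
move=> x /forallPn[j]; rewrite negb_imply -ltnNge => /andP[xm vj].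
by rewrite addnC (bigD1 x) //= (bigD1 j) //= vj -!addnA.
Qed.

Local Open Scope ring_scope.

(** The right level depends on the run through [nbad T]. Summing over all levels with weight 1 / L^p
    removes this dependence, so that the bound can be averaged. *)
Lemma nbad_le_real (R : realFieldType) :
  (nbad T)%:R <= 1 + 2 * (\sum_m (cost 1 m
      + \sum_(l < #|V| + T) ~~ good m l.+1 * cost l.+2 m))%N%:R
    + 2 * 2 ^+ p * \sum_(L < T.+3) (\sum_m cost L m)%N%:R ^+ 2 / L%:R ^+ p :> R.
Proof.
have p_gt0 : (0 < p)%N by lia.
have ex_beta : exists L, (nbad T + 2 <= L ^ p)%N.
  exists T.+2; apply: (@leq_trans (T.+2 ^ 1)); last by rewrite leq_pexp2l.
  by rewrite expn1 -[T.+2]addn2 leq_add2r nbad_le_T.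
case: (ex_minnP ex_beta) => beta bb bmin.
have beta_gt1 : (1 < beta)%N.
  by rewrite ltnNge; apply/negP; case: beta bb {bmin} => [|[|//]]; rewrite ?exp0n ?exp1n; lia.
have beta_le : (beta < T.+3)%N.
  apply: bmin; apply: (@leq_trans (T.+2 ^ 1)); last by rewrite leq_pexp2l.
  by rewrite expn1 -[T.+2]addn2 leq_add2r nbad_le_T.
(* Minimality of [beta] and beta <= 2 (beta - 1) make beta^p comparable to nbad + 2. *)
have beta_exp : (beta ^ p <= 2 ^ p * (nbad T + 2))%N.
  have lt_b : (beta.-1 ^ p < nbad T + 2)%N.
    by rewrite ltnNge; apply/negP => /bmin; lia.
  apply: (@leq_trans (2 ^ p * beta.-1 ^ p)); last by rewrite leq_mul2l (ltnW lt_b) orbT.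
  by rewrite -expnMn leq_exp2r //; lia.
have := nbad_le_cost (ltnW beta_gt1) bb.
set Y := (\sum_m (_ + _))%N; set H := (\sum_m cost beta m)%N => nbad_le.
set S := \sum_(L < _) _.
have H_le : H%:R ^+ 2 / beta%:R ^+ p <= S :> R.
  rewrite /S (bigD1 (Ordinal beta_le)) //= lerDl.
  by apply: sumr_ge0 => L _; rewrite divr_ge0 ?exprn_ge0.
have c_gt0 : 0 < (nbad T)%:R + 2 :> R by rewrite ltr_wpDl.
have H_c : H%:R ^+ 2 / ((nbad T)%:R + 2) <= 2 ^+ p * S :> R.
  apply: (@le_trans _ _ (2 ^+ p * (H%:R ^+ 2 / beta%:R ^+ p))); last first.
    by rewrite ler_pM2l // exprn_gt0.
  rewrite mulrCA ler_wpM2l ?exprn_ge0 //.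
  rewrite ler_pdivlMr ?exprn_gt0 ?ltr0n 1?ltnW // mulrC ler_pdivrMr //.
  by rewrite -[2]/(2%:R) -natrD -!natrX -natrM ler_nat.
have nbad_leR : (nbad T)%:R <= Y%:R + H%:R :> R by rewrite -natrD ler_nat.
(* AM-GM with c = nbad + 2: the term c / 4 is moved to the left-hand side, and H^2 / c is at most
   2^p times the weighted sum. *)
have amgm : H%:R <= H%:R ^+ 2 / ((nbad T)%:R + 2) + ((nbad T)%:R + 2) / 4 :> R.
  set c := _ + 2 in c_gt0 *; rewrite -subr_ge0.
  have -> : H%:R ^+ 2 / c + c / 4 - H%:R = (H%:R - c / 2) ^+ 2 / c :> R.
    by field; rewrite gt_eqF.
  by rewrite divr_ge0 ?sqr_ge0 // ltW.
have Y_ge0 : 0 <= Y%:R :> R by [].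
have S_ge0 : 0 <= 2 ^+ p * S.
  by apply: le_trans H_c; rewrite divr_ge0 ?sqr_ge0 // ltW.
rewrite -mulrA; lra.
Qed.

End Execution.

(** * Greedy MIS under a random ordering *)

Section Greedy.
Variables (V : finType) (adj : rel V).
Implicit Types (pi sigma : {perm V}) (u v : V).

Definition position pi v : nat := enum_rank (pi v).

Definition vertex_at pi (c : 'I_#|V|) : V := (pi^-1)%g (enum_val c).

Fixpoint greedy pi (i : nat) : pred V :=
  if i is i'.+1 then
    [pred v | greedy pi i' v
            || (position pi v == i') && [forall u, greedy pi i' u ==> ~~ adj u v]]
  else pred0.

Definition alive pi i v : bool := [forall u, greedy pi i u ==> ~~ adj u v].

Definition live_pair pi i u v : bool := [&& adj u v, alive pi i u & alive pi i v].

Definition live_window pi w i : bool :=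
  [exists a : 'I_#|V|, exists b : 'I_#|V|,
    [&& i <= a, a < b, b <= i + w
      & live_pair pi i (vertex_at pi a) (vertex_at pi b)]].

(** The product [pi * sigma] applies [pi] first, so such a [sigma] rearranges only the vertices at
    positions [i] and later. *)
Definition fixes_below (i : nat) sigma : Prop :=
  forall c : 'I_#|V|, c < i -> sigma (enum_val c) = enum_val c.

Lemma position_vertex_at pi c : position pi (vertex_at pi c) = c.
Proof. by rewrite /position /vertex_at permKV enum_valK. Qed.

Lemma vertex_at_position pi v : vertex_at pi (enum_rank (pi v)) = v.
Proof. by rewrite /vertex_at enum_rankK permK. Qed.

Lemma position_inj pi : injective (position pi).
Proof. by move=> u v /ord_inj /enum_rank_inj /perm_inj. Qed.

Lemma position_lt pi v : position pi v < #|V|.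
Proof. exact: ltn_ord. Qed.

Lemma aliveP pi i v :
  reflect (forall u, greedy pi i u -> ~~ adj u v) (alive pi i v).
Proof.
apply: (iffP forallP) => H u; first by move=> gu; have := H u; rewrite gu.
by apply/implyP; apply: H.
Qed.

Lemma greedyS pi i v :
  greedy pi i.+1 v = greedy pi i v || (position pi v == i) && alive pi i v.
Proof. by []. Qed.

(** The first [i] greedy decisions look only at the vertices in the first [i] positions. *)
Lemma greedy_fixes pi sigma i : fixes_below i sigma ->
  greedy (pi * sigma)%g i =1 greedy pi i.
Proof.
elim: i => // i IH fixS v.
have {}IH : greedy (pi * sigma)%g i =1 greedy pi i.
  by apply: IH => c ci; apply: fixS; apply: ltnW.
rewrite !greedyS IH; congr (_ || _); congr (_ && _); last first.
  by apply: eq_forallb => u; rewrite IH.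
rewrite /position permM; have [lt_i|ge_i] := ltnP i #|V|; last first.
  by rewrite !ltn_eqF // (leq_trans (ltn_ord _) ge_i).
have fi : sigma (enum_val (Ordinal lt_i)) = enum_val (Ordinal lt_i) by exact: fixS.
rewrite -[i in LHS]/(val (Ordinal lt_i)) -[i in RHS]/(val (Ordinal lt_i)).
rewrite !val_eqE -!(inj_eq enum_val_inj) !enum_rankK -{1}fi.
exact: (inj_eq perm_inj).
Qed.

Lemma alive_fixes pi sigma i v : fixes_below i sigma ->
  alive (pi * sigma)%g i v = alive pi i v.
Proof. by move=> f; apply: eq_forallb => u; rewrite greedy_fixes. Qed.

Lemma vertex_at_mul pi sigma c d : sigma (enum_val d) = enum_val c ->
  vertex_at (pi * sigma)%g c = vertex_at pi d.
Proof. by rewrite /vertex_at => <-; rewrite invMg permM permK. Qed.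

Lemma live_window_fixes pi sigma w i j : i + w < j -> fixes_below j sigma ->
  live_window (pi * sigma)%g w i = live_window pi w i.
Proof.
move=> iwj f; apply: eq_existsb => a; apply: eq_existsb => b.
case: (leqP i a) => //= ia; case: (ltnP a b) => //= ab; case: (leqP b (i + w)) => //= bw.
have fi : fixes_below i sigma by move=> c ci; apply: f; lia.
rewrite /live_pair !alive_fixes // (@vertex_at_mul _ _ a a) ?(@vertex_at_mul _ _ b b) //.
- by apply: f; apply: leq_ltn_trans bw iwj.
- by apply: f; apply: leq_ltn_trans (leq_trans (ltnW ab) bw) iwj.
Qed.

(** * Exchangeability of the positions from [i] on *)

Section Exchange.
Variables (i : nat) (A : {perm V} -> nat).
Hypothesis A_fixes : forall pi sigma, fixes_below i sigma -> A (pi * sigma)%g = A pi.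

Lemma live_pair_exchange (a b a' b' : 'I_#|V|) :
  i <= a -> i <= b -> i <= a' -> i <= b' -> a != b -> a' != b' ->
  \sum_pi A pi * live_pair pi i (vertex_at pi a) (vertex_at pi b)
  = \sum_pi A pi * live_pair pi i (vertex_at pi a') (vertex_at pi b').
Proof.
move=> ia ib ia' ib' ab ab'.
have evI := inj_eq (@enum_val_inj _ (mem V)).
pose X := enum_val a; pose Y := enum_val b.
pose X' := enum_val a'; pose Y' := enum_val b'.
(* The second transposition starts from the image of [Y'] under the first, so the two pairs may
   overlap. *)
pose sigma := (tperm X' X * tperm (tperm X' X Y') Y)%g.
have sX : sigma X' = X.
  rewrite permM tpermL tpermD // ?evI // 1?eq_sym //.
  by rewrite -{1}(tpermL X' X) (inj_eq perm_inj) evI.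
have sY : sigma Y' = Y by rewrite permM tpermL.
have sfix : fixes_below i sigma.
  move=> c ci; have neq (d : 'I_#|V|) : i <= d -> enum_val d != enum_val c.
    by move=> id; rewrite evI; apply/eqP => dc; move: ci; rewrite -dc ltnNge id.
  have t1 : tperm X' X (enum_val c) = enum_val c by apply: tpermD; apply: neq.
  rewrite permM t1 tpermD //; last exact: neq.
  by rewrite -t1 (inj_eq perm_inj) neq.
rewrite (reindex_inj (mulIg sigma)) /=; apply: eq_bigr => pi _.
rewrite A_fixes // /live_pair !alive_fixes //.
by rewrite (vertex_at_mul pi sX) (vertex_at_mul pi sY).
Qed.

End Exchange.

(** If the pair is live at [i], the vertex at position [i] is selected greedily and kills the one at
    [z], so the pair is not live at any later [j]. *)
Lemma killed_at_most_once pi (z : 'I_#|V|) :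
  \sum_(i < #|V| | i < z) live_pair pi i (vertex_at pi i) (vertex_at pi z) <= 1.
Proof.
have [noone|/forallPn[/= i]] :=
    boolP [forall i : 'I_#|V|,
      (i < z) ==> ~~ live_pair pi i (vertex_at pi i) (vertex_at pi z)].
  rewrite big1 // => i iz; move/forallP/(_ i): noone.
  by rewrite iz /= => /negPf ->.
rewrite negb_imply negbK => /andP[iz li].
rewrite (bigD1 i) //= big1 ?addn0 ?leq_b1 // => j /andP[jz ji].
wlog suff gen : i j li iz jz ji / i < j -> ~~ live_pair pi j (vertex_at pi j) (vertex_at pi z).
  case: (ltngtP i j) => [ij|ji'|/val_inj ij]; last by rewrite ij eqxx in ji.
  - by rewrite (negPf (gen i j li iz jz ji ij)).
  - case lj: (live_pair _ _ _ _) => //.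
    by have := gen j i lj jz iz; rewrite eq_sym ji ji' li => /(_ isT isT).
move=> ij; rewrite /live_pair !negb_and; apply/orP; right; apply/orP; right.
apply/negP => /aliveP alz; case/and3P: li => aiz ai _.
suff /alz : greedy pi j (vertex_at pi i) by rewrite aiz.
elim: (val j) ij => // k IH; rewrite ltnS leq_eqVlt => /orP[/eqP <-|/IH gk].
  by rewrite greedyS position_vertex_at eqxx ai orbT.
by rewrite greedyS gk.
Qed.

Lemma live_window_le pi w i :
  live_window pi w i <=
  \sum_(al < w.+1) \sum_(ga < w.+1)
   \sum_(a < #|V| | a == i + al :> nat) \sum_(b < #|V| | (b == i + ga :> nat) && (a < b))
     live_pair pi i (vertex_at pi a) (vertex_at pi b).
Proof.
case lw: (live_window _ _ _) => //.
move/existsP: lw => [a /existsP[b /and4P[ia ab bw l]]].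
have al_lt : a - i < w.+1 by lia.
have ga_lt : b - i < w.+1 by lia.
rewrite (bigD1 (Ordinal al_lt)) //= (bigD1 (Ordinal ga_lt)) //=.
have ib : i <= b by exact: leq_trans ia (ltnW ab).
by rewrite (bigD1 a) ?subnKC //= (bigD1 b) ?eqxx ?ab ?l.
Qed.

Lemma leq_sum_ord1 n (P : pred 'I_n) (F : 'I_n -> nat) k B :
  (forall a, P a -> a = k :> nat) -> (forall a, P a -> F a <= B) ->
  \sum_(a | P a) F a <= B.
Proof.
move=> Pk FB; case: (pickP P) => [a Pa|none]; last by rewrite big_pred0.
rewrite (bigD1 a) //= big1 ?addn0 ?FB // => b /andP[Pb /eqP[]].
by apply: val_inj; rewrite /= (Pk a) // (Pk b).
Qed.

(** A live window is split by the offsets of its two vertices. Each of the (w+1)^2 offset pairs is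
    exchanged for positions [i] and [#|V|.-1], and the resulting events are disjoint over [i]. The
    weight [A], which sees only the first [i] positions, serves the second moment. *)
Lemma sum_live_window (A : nat -> {perm V} -> nat) (c : {perm V} -> nat) w :
  (forall i pi sigma, fixes_below i sigma -> A i (pi * sigma)%g = A i pi) ->
  (forall i pi, A i pi <= c pi) ->
  \sum_pi \sum_(i < #|V|) A i pi * live_window pi w i
  <= w.+1 ^ 2 * \sum_pi c pi.
Proof.
move=> A_fixes A_le.
case: (posnP #|V|) => [V0|V_gt0].
  by rewrite big1 // => pi _; rewrite big1 // => i _; have := ltn_ord i; rewrite {2}V0.
have ell_lt : #|V|.-1 < #|V| by rewrite prednK.
pose ell := Ordinal ell_lt.
pose S al ga i := \sum_(a < #|V| | a == i + al :> nat)
  \sum_(b < #|V| | (b == i + ga :> nat) && (a < b))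
  \sum_pi A i pi * live_pair pi i (vertex_at pi a) (vertex_at pi b).
have S_le al ga (i : 'I_#|V|) : S al ga i <= (i < ell) *
    \sum_pi A i pi * live_pair pi i (vertex_at pi i) (vertex_at pi ell).
  apply: (@leq_sum_ord1 _ _ _ (i + al)) => [a /eqP//|a /eqP ai].
  apply: (@leq_sum_ord1 _ _ _ (i + ga)) => [b /andP[/eqP]//|b /andP[/eqP bi ab]].
  have b_le : b <= ell by rewrite /= -ltnS prednK.
  have ia : i <= a by rewrite ai leq_addr.
  have ib : i <= b by rewrite bi leq_addr.
  have i_lt : i < ell by exact: leq_ltn_trans ia (leq_trans ab b_le).
  have a_b : a != b by rewrite -val_eqE ltn_eqF.
  have i_ell : i != ell by rewrite -val_eqE ltn_eqF.
  by rewrite i_lt mul1n (live_pair_exchange (A_fixes i) ia ib (leqnn i) (ltnW i_lt)).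
apply: (@leq_trans (\sum_(al < w.+1) \sum_(ga < w.+1) \sum_(i < #|V|) S al ga i)).
  rewrite exchange_big /=.
  apply: (@leq_trans (\sum_(i < #|V|) \sum_(al < w.+1) \sum_(ga < w.+1) S al ga i));
    last first.
    rewrite exchange_big /=; apply: leq_sum => al _.
    by rewrite exchange_big.
  apply: leq_sum => i _.
  apply: (@leq_trans (\sum_pi \sum_(al < w.+1) \sum_(ga < w.+1)
     \sum_(a < #|V| | a == i + al :> nat) \sum_(b < #|V| | (b == i + ga :> nat) && (a < b))
     A i pi * live_pair pi i (vertex_at pi a) (vertex_at pi b))).
    apply: leq_sum => pi _; apply: leq_trans (leq_mul (leqnn _) (live_window_le pi w i)) _.
    rewrite big_distrr; apply: leq_sum => al _; rewrite big_distrr; apply: leq_sum => ga _.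
    rewrite big_distrr; apply: leq_sum => a _; rewrite big_distrr; apply: leq_sum => b _.
    exact: leqnn.
  rewrite exchange_big; apply: leq_sum => al _; rewrite exchange_big; apply: leq_sum => ga _.
  rewrite exchange_big; apply: leq_sum => a _; rewrite exchange_big; apply: leq_sum => b _.
  exact: leqnn.
have -> : w.+1 ^ 2 * \sum_pi c pi = \sum_(al < w.+1) \sum_(ga < w.+1) \sum_pi c pi.
  by rewrite !sum_nat_const !card_ord mulnA.
apply: leq_sum => al _; apply: leq_sum => ga _.
apply: (@leq_trans (\sum_(i < #|V|) (i < ell) *
    \sum_pi A i pi * live_pair pi i (vertex_at pi i) (vertex_at pi ell))).
  by apply: leq_sum => i _; apply: S_le.
apply: (@leq_trans (\sum_(i < #|V|) \sum_pi (i < ell) *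
    (A i pi * live_pair pi i (vertex_at pi i) (vertex_at pi ell)))).
  by apply: leq_sum => i _; rewrite big_distrr.
rewrite exchange_big; apply: leq_sum => pi _ /=.
rewrite -[X in _ <= X]muln1; apply: leq_trans (leq_mul (leqnn _) (killed_at_most_once pi ell)).
rewrite [X in _ <= _ * X]big_mkcond big_distrr /=; apply: leq_sum => i _.
by case: ifP => _; rewrite ?mul0n // mul1n leq_mul2r A_le orbT.
Qed.

Lemma sum_live_window1 w :
  \sum_pi \sum_(i < #|V|) live_window pi w i <= w.+1 ^ 2 * #|{perm V}|.
Proof.
have := @sum_live_window (fun _ _ => 1) (fun=> 1) w (fun _ _ _ _ => erefl)
  (fun _ _ => leqnn 1).
rewrite sum1_card; apply: leq_trans; apply: leq_sum => pi _; apply: leq_sum => i _.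
by rewrite mul1n.
Qed.

Lemma sqr_sum_le n (F : 'I_n -> nat) :
  (\sum_i F i) ^ 2 <= 2 * \sum_i F i * \sum_(j : 'I_n | i <= j) F j.
Proof.
rewrite -mulnn big_distrl /= mul2n -addnn.
have split (i : 'I_n) :
    \sum_j F j = \sum_(j : 'I_n | i <= j) F j + \sum_(j : 'I_n | j < i) F j.
  rewrite (bigID (fun j : 'I_n => i <= j)) /=; congr (_ + _).
  by apply: eq_bigl => j; rewrite ltnNge.
under eq_bigr => i _ do rewrite (split i) mulnDr.
rewrite big_split leq_add2l /=.
under eq_bigr => i _ do rewrite big_distrr /=.
rewrite (exchange_big_dep xpredT) //=; apply: leq_sum => i _.
rewrite big_distrr /= big_mkcond [X in _ <= X]big_mkcond /=; apply: leq_sum => j _.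
by case: (ltngtP i j) => // _; rewrite mulnC.
Qed.

(** For each [i], the indices [j] up to [i + w] contribute at most w + 1. For [j] beyond, the
    indicator at [i] depends only on positions below [j], so it is an admissible weight in
    [sum_live_window]. *)
Lemma sum_live_window2 w :
  \sum_pi (\sum_(i < #|V|) live_window pi w i) ^ 2
  <= 4 * w.+1 ^ 4 * #|{perm V}|.
Proof.
pose z pi i := (live_window pi w i : nat).
have near pi (i : 'I_#|V|) :
    \sum_(j < #|V| | i <= j) z pi j <= w.+1 + \sum_(j < #|V|) (i + w < j) * z pi j.
  rewrite (bigID (fun j : 'I_#|V| => i + w < j)) /= addnC; apply: leq_add; last first.
    rewrite big_mkcond; apply: leq_sum => j _.
    by case: ifP => [/andP[_ ->]|//]; rewrite mul1n.
  apply: (@leq_trans (\sum_(j < #|V| | (i <= j) && ~~ (i + w < j)) 1)).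
    by apply: leq_sum => j _; apply: leq_b1.
  rewrite sum1_card -[X in _ <= X](card_ord w.+1).
  pose f (j : 'I_#|V|) : 'I_w.+1 := inord (j - i).
  rewrite -(@card_in_imset _ _ f); first by rewrite max_card.
  move=> j k; rewrite !unfold_in => /andP[ij jw] /andP[ik kw].
  move=> /(congr1 (@nat_of_ord _)); rewrite /f !inordK ?ltnS ?leq_subLR ?[_ <= i + w]leqNgt //.
  by move=> jk; apply: val_inj; rewrite /= -(subnK ij) -(subnK ik) jk.
have second (i : 'I_#|V|) :
    \sum_pi z pi i * (\sum_(j < #|V|) (i + w < j) * z pi j) <= w.+1 ^ 2 * \sum_pi z pi i.
  apply: leq_trans (@sum_live_window (fun j pi => (i + w < j) * z pi i) (z^~ i) w _ _).
  - by apply: leq_sum => pi _; rewrite big_distrr /=; apply: leq_sum => j _;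
      rewrite mulnCA mulnA.
  - move=> j pi sigma f; case: ltnP => // iw; rewrite /z.
    by rewrite (live_window_fixes _ iw f).
  - by move=> j pi; case: ltnP => //; rewrite mul1n.
have total : \sum_pi \sum_(i < #|V|) z pi i * \sum_(j < #|V| | i <= j) z pi j
    <= (w.+1 + w.+1 ^ 2) * \sum_pi \sum_(i < #|V|) z pi i.
  apply: (@leq_trans (\sum_pi \sum_(i < #|V|) (z pi i * w.+1
      + z pi i * \sum_(j < #|V|) (i + w < j) * z pi j))).
    apply: leq_sum => pi _; apply: leq_sum => i _; rewrite -mulnDr.
    by rewrite leq_mul2l near orbT.
  rewrite exchange_big /= [X in _ <= _ * X]exchange_big big_distrr /=.
  apply: leq_sum => i _; rewrite big_split mulnDl; apply: leq_add; last exact: second.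
  by rewrite -big_distrl mulnC.
apply: (@leq_trans (2 * \sum_pi \sum_(i < #|V|) z pi i * \sum_(j < #|V| | i <= j) z pi j)).
  by rewrite big_distrr /=; apply: leq_sum => pi _; apply: sqr_sum_le.
apply: leq_trans (leq_mul (leqnn 2) total) _.
have := sum_live_window1 w; rewrite -/(z _ _).
set a := \sum_pi _; set n := #|_| => an.
apply: (@leq_trans (2 * ((w.+1 + w.+1 ^ 2) * (w.+1 ^ 2 * n)))).
  by rewrite !leq_mul2l an !orbT.
have -> : 4 * w.+1 ^ 4 * n = 2 * (2 * w.+1 ^ 2 * (w.+1 ^ 2 * n)) by ring.
rewrite leq_mul2l leq_mul2r mul2n -addnn leq_add2r.
by rewrite -[X in X <= _]expn1 leq_pexp2l ?orbT.
Qed.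

End Greedy.

(** * Runs of the algorithm *)

Definition window_cost (V : finType) (adj : rel V) (pi : {perm V}) (L i : nat) : nat :=
  L ^ 2 * live_window adj pi (7 * L ^ 6) i.

Lemma leq_sum_widen n n' (F G : nat -> nat) : n <= n' ->
  (forall i, i < n -> F i <= G i) -> \sum_(i < n) F i <= \sum_(i < n') G i.
Proof.
move=> nn FG; rewrite -(big_mkord xpredT G) (@big_cat_nat _ _ _ n) //= big_mkord.
by apply: leq_trans (leq_addr _ _); apply: leq_sum => i _; apply: FG.
Qed.

Section Run.
Variables (d : measure_display) (Omega : measurableType d) (V : finType).
Variables (adj : rel V) (Q : scheduler Omega V).
Hypotheses (adj_sym : symmetric adj) (adj_irr : irreflexive adj).
Variables (pi : {perm V}) (w : Omega).

Local Notation pos := (position pi).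
Local Notation greedyb := (greedy adj pi).
Local Notation aliveb := (alive adj pi).

Lemma greedyE i v : greedyb i v = (pos v < i) && aliveb (pos v) v.
Proof.
elim: i => // i IH; rewrite greedyS IH ltnS [pos v <= i]leq_eqVlt.
by case: eqP => [<-|_]; rewrite ?ltnn /= ?orbF.
Qed.

Lemma greedy_indep u v : aliveb (pos u) u -> aliveb (pos v) v -> ~~ adj u v.
Proof.
wlog uv : u v / pos u < pos v => [gen|] au av.
  case: (ltngtP (pos u) (pos v)) => [uv|vu|/position_inj ->].
  - exact: gen.
  - by rewrite adj_sym; apply: gen.
  - by rewrite adj_irr.
by move/aliveP: av; apply; rewrite greedyE uv.
Qed.

(** The last field is the essential one: whatever the queue answers, only vertices of the greedy MIS
    are selected. *)
Record mis_inv (s : mis_state V) : Prop := MisInv {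
  inv_uniq : uniq (contents (hist s));
  inv_label : forall y, y \in contents (hist s) -> y.2 = label pi y.1;
  inv_out : forall v, ~~ in_queue (hist s) v -> (v \in indep s) || (v \in dead s);
  inv_dead : forall v, (v \in dead s) = [exists u, (u \in indep s) && adj u v];
  inv_indep : forall u, u \in indep s -> aliveb (pos u) u
}.

Section Invariant.
Variable s : mis_state V.
Hypothesis sI : mis_inv s.

Lemma in_queueE v : in_queue (hist s) v = ((v, label pi v) \in contents (hist s)).
Proof.
apply/hasP/idP => [[y yc /eqP <-]|vc]; last by exists (v, label pi v) => /=.
by rewrite -(inv_label sI yc) -surjective_pairing.
Qed.

Lemma inverted_hasE u v :
  has (fun y : entry V => (y.1 == u) && (y.2 < label pi v)) (contents (hist s))
  = in_queue (hist s) u && (pos u < pos v).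
Proof.
rewrite in_queueE; apply/hasP/andP => [[y yc /andP[/eqP yu yv]]|[uc uv]].
  have y2 := inv_label sI yc; rewrite yu in y2; rewrite y2 in yv.
  by split; rewrite // -y2 -yu -surjective_pairing.
by exists (u, label pi u) => //=; rewrite eqxx.
Qed.

Lemma rankE v :
  rank (hist s) (v, label pi v)
  = #|[pred u | (u \in [set u | in_queue (hist s) u]) && (pos u < pos v)]|.+1.
Proof.
rewrite /rank /= -size_filter; congr _.+1; set c := contents _.
have fst_inj : {in [seq y <- c | y.2 < label pi v] &, injective (fun y : entry V => y.1)}.
  move=> [a1 a2] [b1 b2]; rewrite !mem_filter => /andP[_ ac] /andP[_ bc] /= ab.
  by have /= -> := inv_label sI ac; have /= -> := inv_label sI bc; rewrite ab.
rewrite -(size_map fst) -(card_uniqP _); last first.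
  by rewrite map_inj_in_uniq // filter_uniq // inv_uniq.
apply: eq_card => u; rewrite !inE.
apply/mapP/andP => [[y]|[uq uv]].
  rewrite mem_filter => /andP[yv yc] ->.
  by rewrite in_queueE -(inv_label sI yc) -surjective_pairing; split=> //;
    rewrite (inv_label sI yc) in yv.
by exists (u, label pi u) => //; rewrite mem_filter /= -in_queueE uq andbT.
Qed.

Lemma greedy_not_dead g : aliveb (pos g) g -> g \notin dead s.
Proof.
move=> ag; rewrite (inv_dead sI); apply/negP => /existsP[u /andP[/(inv_indep sI) au]].
exact/negP/greedy_indep.
Qed.

(* A selected vertex that has left the queue has already killed its neighbours. *)
Lemma live_not_adj_greedy g v : aliveb (pos g) g -> ~~ in_queue (hist s) g ->
  v \notin dead s -> ~~ adj g v.
Proof.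
move=> ag gq; have := inv_out sI gq; rewrite (negPf (greedy_not_dead ag)) orbF => gi.
by rewrite (inv_dead sI); apply: contra => gv; apply/existsP; exists g; rewrite gi.
Qed.

Hypothesis s_run : running s.
Let x := approx_get_min Q w (hist s).
Let v := x.1.
Let blocked := [exists u, [&& predecessor adj pi u v, u \notin dead s
                           & in_queue (GetMin x :: hist s) u]].
Let h' := GetMin x :: hist s.

Lemma get_min_entry : x = (v, label pi v).
Proof. by rewrite -(inv_label sI (approx_get_min_in Q w s_run)) -surjective_pairing. Qed.

Lemma get_min_in_queue : in_queue (hist s) v.
Proof. by rewrite in_queueE -get_min_entry; apply: approx_get_min_in. Qed.

Lemma in_queue_get_min u : in_queue h' u = in_queue (hist s) u && (u != v).
Proof.
have cI : forall y, y \in contents h' -> y \in contents (hist s) by move=> y /mem_rem.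
have -> : in_queue h' u = ((u, label pi u) \in contents h').
  apply/hasP/idP => [[y yc /eqP <-]|uc]; last by exists (u, label pi u) => /=.
  by rewrite -(inv_label sI (cI _ yc)) -surjective_pairing.
rewrite /= mem_rem_uniq ?(inv_uniq sI) // in_queueE inE andbC; congr (_ && _).
rewrite get_min_entry xpair_eqE; case: eqP => [->|]; first by rewrite eqxx.
by [].
Qed.

Lemma blockedP : reflect
  (exists u, [/\ adj u v, pos u < pos v, u \notin dead s & in_queue (hist s) u]) blocked.
Proof.
apply: (iffP existsP) => [[u /and3P[/andP[uv luv] ud]]|[u [uv luv ud uq]]].
  by rewrite -/h' in_queue_get_min => /andP[uq _]; exists u; split.
exists u; rewrite /predecessor uv /label ltnS luv ud -/h' in_queue_get_min uq /=.
by apply: contraTneq luv => ->; rewrite ltnn.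
Qed.

Lemma mis_inv_step : mis_inv (mis_iteration adj Q pi w s).
Proof.
have out' u : ~~ in_queue h' u -> u = v \/ ~~ in_queue (hist s) u.
  by rewrite in_queue_get_min negb_and negbK => /orP[|/eqP]; [right|left].
have uniq' : uniq (contents h') by apply: rem_uniq; apply: inv_uniq.
have label' y : y \in contents h' -> y.2 = label pi y.1.
  by move=> /mem_rem /(inv_label sI).
rewrite /mis_iteration -/x -/v -/h' -/blocked.
case: ifPn => vd.
  split => //=; first by move=> u /out' [->|/(inv_out sI)//]; rewrite vd orbT.
  - exact: inv_dead sI.
  - exact: inv_indep sI.
case: ifPn => [bl|/blockedP nbl].
  split=> /=.
  - rewrite uniq' andbT -get_min_entry mem_rem_uniq ?(inv_uniq sI) //.
    by rewrite inE eqxx.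
  - by move=> y; rewrite inE => /orP[/eqP ->|/label'].
  - move=> u; rewrite /in_queue /= negb_or => /andP[vu uq].
    have [uv|uq'] := out' u uq; last exact: inv_out sI _ uq'.
    by rewrite uv eqxx in vu.
  - exact: inv_dead sI.
  - exact: inv_indep sI.
(* An adjacent greedy vertex before [v] is never dead. In the queue it would block [v]; outside it
   would already have killed [v]. *)
have av : aliveb (pos v) v.
  apply/aliveP => g; rewrite greedyE => /andP[gv ag].
  apply/negP => adj_gv; apply: nbl; exists g; split=> //; first exact: greedy_not_dead.
  by apply: contraTT adj_gv => gq; apply: live_not_adj_greedy vd.
split=> //=.
- move=> u /out' [->|/(inv_out sI)/orP[ui|ud]].
  + by rewrite !inE eqxx.
  + by rewrite !inE ui orbT.
  + by rewrite !inE ud !orbT.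
- move=> u; rewrite !inE (inv_dead sI).
  apply/orP/existsP => [[/existsP[g /andP[gi gu]]|vu]|[g]].
  + by exists g; rewrite !inE gi orbT.
  + by exists v; rewrite !inE eqxx.
  + rewrite !inE => /andP[/orP[/eqP ->|gi] gu]; [by right|left].
    by apply/existsP; exists g; rewrite gi.
- by move=> u; rewrite !inE => /orP[/eqP ->|/(inv_indep sI)].
Qed.

End Invariant.

(** * A run of the algorithm as an abstract execution *)

Local Notation st := (mis_run adj Q pi w).

Lemma mis_runS t : st t.+1 = mis_step adj Q pi w (st t).
Proof. by []. Qed.

Lemma contents_init : contents (hist (mis_init pi)) = [seq (v, label pi v) | v <- enum V].
Proof. by rewrite /=; elim: (enum V) => //= v s ->. Qed.

Lemma mis_inv_init : mis_inv (mis_init pi).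
Proof.
have init_label y : y \in contents (hist (mis_init pi)) -> y.2 = label pi y.1.
  by rewrite contents_init => /mapP[v _ ->].
split=> //; rewrite ?contents_init.
- by rewrite map_inj_uniq ?enum_uniq // => u v [].
- move=> v; rewrite /in_queue contents_init => /hasPn /(_ (v, label pi v)) /=.
  by rewrite map_f ?mem_enum // eqxx => /(_ isT).
- by move=> v; rewrite inE; apply/esym/existsP => -[u]; rewrite inE.
- by move=> u; rewrite inE.
Qed.

Lemma mis_inv_run t : mis_inv (st t).
Proof.
elim: t => [|t IH]; first exact: mis_inv_init.
by rewrite mis_runS /mis_step; case: ifP => // /(mis_inv_step IH).
Qed.

(** Steps after termination are the identity, so a run cut off at [T] is a run of [T'] genuine
    iterations. *)
Lemma running_prefix T : exists T', [/\ T' <= T, forall t, t < T' -> running (st t),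
  st T' = st T & \sum_(t < T) running (st t) = T'].
Proof.
suff [T' [? ? ? ? _]] : exists T', [/\ T' <= T, forall t, t < T' -> running (st t),
    st T' = st T, \sum_(t < T) running (st t) = T' & running (st T) -> T' = T].
  by exists T'; split.
elim: T => [|T [T' [T'T run sT' sumT eT]]]; first by exists 0; rewrite big_ord0.
case rT: (running (st T)); last first.
  exists T'; rewrite mis_runS /mis_step rT sT' big_ord_recr /= sumT rT addn0.
  by split=> //; apply: ltnW.
have {}eT := eT rT; exists T.+1.
rewrite big_ord_recr /= sumT rT eT addn1; split=> // t.
by rewrite ltnS leq_eqVlt => /orP[/eqP ->//|tT]; apply: run; rewrite eT.
Qed.

Let ret t := (approx_get_min Q w (hist (st t))).1.
Let bad t := (ret t \notin dead (st t))
  && [exists u, [&& predecessor adj pi u (ret t), u \notin dead (st t)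
      & in_queue (GetMin (approx_get_min Q w (hist (st t))) :: hist (st t)) u]].
Let Qs t : {set V} := [set v | in_queue (hist (st t)) v].

Lemma hist_step t : running (st t) ->
  hist (st t.+1) = let h := GetMin (ret t, label pi (ret t)) :: hist (st t) in
    if bad t then Insert (ret t, label pi (ret t)) :: h else h.
Proof.
move=> rt; rewrite mis_runS /mis_step rt /mis_iteration /bad -/(ret t).
rewrite -(get_min_entry (mis_inv_run t) rt).
by case: (ret t \in dead (st t)) => //=; case: ifP.
Qed.

Lemma in_queue_step t v : running (st t) ->
  (v \in Qs t.+1) = (v \in Qs t) && (bad t || (v != ret t)).
Proof.
move=> rt; rewrite !inE hist_step //= -(get_min_entry (mis_inv_run t) rt).
have E := in_queue_get_min (mis_inv_run t) rt v.
case: (bad t) => /=; last exact: E.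
set h := GetMin _ :: _ in E *.
rewrite andbT -[LHS]/((ret t == v) || in_queue h v) E.
have [->|_] := eqVneq v (ret t); first by rewrite (get_min_in_queue (mis_inv_run t)).
by rewrite andbT.
Qed.

Lemma insertions_step t v : running (st t) ->
  insertions v (hist (st t.+1)) = insertions v (hist (st t)) + (bad t && (v == ret t)).
Proof.
move=> rt; rewrite hist_step //=; case: (bad t) => /=; last by rewrite addn0.
by rewrite /insertions /= add0n addnC eq_sym.
Qed.

Lemma inversions_step t v j : running (st t) ->
  inversions v j (hist (st t.+1)) = inversions v j (hist (st t))
    + [&& insertions v (hist (st t)) == j, v \in Qs t & pos v < pos (ret t)].
Proof.
move=> rt; rewrite hist_step //= addnC.
have E := inverted_hasE (mis_inv_run t) v (ret t).
by case: (bad t) => /=; rewrite E inE.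
Qed.

Lemma bad_predecessor t : running (st t) -> bad t ->
  exists u, [/\ adj u (ret t), pos u < pos (ret t), u \notin dead (st t) & u \in Qs t].
Proof.
move=> rt /andP[_ /(blockedP (mis_inv_run t) rt)[u [? ? ? ?]]].
by exists u; rewrite inE.
Qed.

Lemma insertions_init v : insertions v (hist (mis_init pi)) = 1.
Proof.
rewrite /insertions /= count_map.
by rewrite -[LHS]/(count_mem v (enum V)) count_uniq_mem ?enum_uniq // mem_enum.
Qed.

Lemma inversions_init v j : inversions v j (hist (mis_init pi)) = 0.
Proof. by rewrite /=; elim: (enum V). Qed.

(** Greedy vertices before the top [m] have left the queue and killed their neighbours. So the
    returned vertex and its live predecessor are both alive after the prefix before [m], and both
    lie at or after [m]. *)
Lemma live_window_bad t m c : running (st t) -> bad t -> top pos Qs t m ->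
  pos (ret t) <= pos m + c -> live_window adj pi c (pos m).
Proof.
move=> rt bt /topP[mQ mmin] rc; have [u [ur pu ud uQ]] := bad_predecessor rt bt.
have tI := mis_inv_run t.
have live v : v \notin dead (st t) -> aliveb (pos m) v.
  move=> vd; apply/aliveP => g; rewrite greedyE => /andP[gm ag].
  apply: (live_not_adj_greedy tI ag _ vd); apply: contraL gm => gq.
  by rewrite -leqNgt; apply: mmin; rewrite inE.
apply/existsP; exists (enum_rank (pi u)); apply/existsP; exists (enum_rank (pi (ret t))).
rewrite !vertex_at_position /live_pair ur !live //; last by case/andP: bt.
rewrite -!/(position pi _) pu rc mmin //.
Qed.

Definition rank_excess (p L t : nat) (m : V) : bool :=
  running (st t)
  && (L ^ p * (gap t (pos m)).+1 < rank (hist (st t)) (approx_get_min Q w (hist (st t))) ^ p).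

Definition inversion_excess (p L T : nat) (m x : V) (j : nat) : bool :=
  L ^ p * (pos m - pos x).+1 * j.+1 < inversions x j (hist (st T)) ^ p.

(** The charges above the typical level, with the failure indicator replaced by its union bound and
    all ranges fixed by [T], independently of the seed. *)
Definition excess_cost (p T : nat) : nat :=
  \sum_m (window_cost adj pi 1 (pos m)
    + \sum_(l < #|V| + T)
        (\sum_(t < T) rank_excess p l.+1 t m
         + \sum_(x | pos x <= pos m) \sum_(j < T.+2) inversion_excess p l.+1 T m x j)
        * window_cost adj pi l.+2 (pos m)).

Local Open Scope ring_scope.

Lemma running_bound (R : realFieldType) (p T : nat) : (36 <= p)%N ->
  (\sum_(t < T) running (st t))%N%:R <= #|V|%:R + (1 + 2 * (excess_cost p T)%:R
    + 2 * 2 ^+ p * \sum_(L < T.+3)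
        (\sum_m window_cost adj pi L (pos m))%N%:R ^+ 2 / L%:R ^+ p) :> R.
Proof.
move=> p_ge; have [T' [T'T run sT' ->]] := running_prefix T.
have Q0 v : v \in Qs 0.
  rewrite inE; apply: contraT => /(inv_out mis_inv_init).
  by rewrite !inE.
have retQ t : (t < T')%N -> ret t \in Qs t.
  by move=> /run rt; rewrite inE; apply: get_min_in_queue (mis_inv_run t) rt.
have QS t v : (t < T')%N -> (v \in Qs t.+1) = (v \in Qs t) && (bad t || (v != ret t)).
  by move=> /run; apply: in_queue_step.
have insS t v : (t < T')%N -> insertions v (hist (st t.+1))
    = (insertions v (hist (st t)) + (bad t && (v == ret t)))%N.
  by move=> /run; apply: insertions_step.
have invS t v j : (t < T')%N -> inversions v j (hist (st t.+1))
    = (inversions v j (hist (st t))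
       + [&& insertions v (hist (st t)) == j, v \in Qs t & (pos v < pos (ret t))%N])%N.
  by move=> /run; apply: inversions_step.
have badP t : (t < T')%N -> bad t -> exists2 u, u \in Qs t & (pos u < pos (ret t))%N.
  by move=> /run rt /(bad_predecessor rt)[u [_ ? _ ?]]; exists u.
have badW t m c : (t < T')%N -> bad t -> top pos Qs t m ->
    (pos (ret t) <= pos m + c)%N -> live_window adj pi c (pos m).
  by move=> /run rt; apply: live_window_bad.
have := steps_le Q0 retQ QS.
rewrite -(ler_nat R) natrD => /le_trans; apply; rewrite lerD2l.
have := @nbad_le_real V pos (@position_inj _ pi) (@position_lt _ pi) T' Qs ret bad
  (fun t v => insertions v (hist (st t))) (fun t v j => inversions v j (hist (st t)))
  Q0 insertions_init retQ QS insS invS badP p (fun c m => live_window adj pi c (pos m))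
  p_ge inversions_init badW R.
(* The true length [T'] depends on the seed; the sums are extended to [T] by nonnegative terms. *)
move=> /le_trans; apply; apply: lerD; last first.
  rewrite ler_pM2l ?mulr_gt0 ?exprn_gt0 //.
  rewrite -!(big_mkord xpredT
    (fun L => (\sum_m window_cost adj pi L (pos m))%N%:R ^+ 2 / L%:R ^+ p : R)).
  rewrite [leRHS](@big_cat_nat _ _ _ T'.+3) //= lerDl.
  by apply: sumr_ge0 => L _; rewrite divr_ge0 ?exprn_ge0.
rewrite lerD2l ler_pM2l // ler_nat; apply: leq_sum => m _; rewrite leq_add2l.
have le_T : (#|V| + T' <= #|V| + T)%N by rewrite leq_add2l.
pose viol l := ~~ good pos T' Qs ret (fun t v j => inversions v j (hist (st t))) p m l.+1.
pose excess l := (\sum_(t < T) rank_excess p l.+1 t m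
  + \sum_(x | pos x <= pos m) \sum_(j < T.+2) inversion_excess p l.+1 T m x j)%N.
apply: (@leq_sum_widen _ _ (fun l => viol l * window_cost adj pi l.+2 (pos m))%N
  (fun l => excess l * window_cost adj pi l.+2 (pos m))%N) => // l _.
rewrite leq_mul2r; apply/orP; right.
apply: leq_trans (not_good_le _ _ _ _ _ _ _ _) _.
apply: leq_add.
  pose F t := nat_of_bool (l.+1 ^ p * (gap t (pos m)).+1 < (low pos Qs t (ret t)).+1 ^ p)%N.
  apply: (@leq_sum_widen _ _ F (fun t => rank_excess p l.+1 t m)) => // t tT'.
  have tI := mis_inv_run t.
  rewrite /rank_excess run // (get_min_entry tI (run _ tT')) (rankE tI).
  exact: leqnn.
apply: leq_sum => x _.
pose F j := nat_of_bool (l.+1 ^ p * (pos m - pos x).+1 * j.+1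
                         < inversions x j (hist (st T')) ^ p)%N.
apply: (@leq_sum_widen _ _ F (fun j => inversion_excess p l.+1 T m x j)) => // j _.
by rewrite /inversion_excess -sT'.
Qed.

End Run.

Local Open Scope ring_scope.

(** * Measurability and means *)

Section Measurability.
Variables (d : measure_display) (Omega : measurableType d) (V : finType).
Variables (adj : rel V) (Q : scheduler Omega V) (pi : {perm V}).

(** The answer ranges over the finitely many entries of the queue, so the event is a finite
    union. *)
Lemma measurable_get_min (F : entry V -> Omega -> Prop) (h : history V) :
  contents h != [::] -> (forall x, measurable [set w | F x w]%classic) ->
  measurable [set w | F (approx_get_min Q w h) w]%classic.
Proof.
move=> h0 mF.
rewrite (_ : [set w | _]%classic = (\bigcup_(x in [set` contents h])
    ([set w | approx_get_min Q w h = x] `&` [set w | F x w]))%classic).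
  apply: fin_bigcup_measurable; first exact: finite_seq.
  by move=> x _; apply: measurableI => //; apply: approx_get_min_measurable.
apply/seteqP; split => w /= => [Fw|[x _ [-> //]]].
by exists (approx_get_min Q w h) => //=; apply: approx_get_min_in.
Qed.

(** Induction on [t] over all start states: fixing the first answer leaves a shorter run from a
    state that does not depend on the seed. *)
Lemma measurable_run (F : Omega -> mis_state V -> Prop) t :
  (forall s, measurable [set w | F w s]%classic) ->
  measurable [set w | F w (mis_run adj Q pi w t)]%classic.
Proof.
move=> mF; rewrite /mis_run; elim: t (mis_init pi) => [|t IH] s; first exact: mF.
under eq_set do rewrite iterSr.
case rs: (running s); last first.
  rewrite (_ : [set w | _]%classic =
    [set w | F w (iter t (mis_step adj Q pi w) s)]%classic) //.
  by apply/seteqP; split => w /=; rewrite /mis_step rs.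
pose step (x : entry V) := let v := x.1 in let h := GetMin x :: hist s in
  if v \in dead s then MisState h (dead s) (indep s)
  else if [exists u, [&& predecessor adj pi u v, u \notin dead s & in_queue h u]]
  then MisState (Insert (v, label pi v) :: h) (dead s) (indep s)
  else MisState h (dead s :|: [set u | adj v u]) (v |: indep s).
pose G x w := F w (iter t (mis_step adj Q pi w) (step x)).
rewrite (_ : [set w | _]%classic = [set w | G (approx_get_min Q w (hist s)) w]%classic).
  by apply: measurable_get_min => // x; apply: IH.
by apply/seteqP; split => w /=; rewrite /G /mis_step rs.
Qed.

Lemma measurable_state (F : mis_state V -> Prop) t :
  measurable [set w | F (mis_run adj Q pi w t)]%classic.
Proof.
apply: (measurable_run (F := fun _ => F)) => s.
have [Fs|nFs] := pselect (F s).
  by rewrite (_ : [set w | _]%classic = setT) //; apply/seteqP; split.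
by rewrite (_ : [set w | _]%classic = classical_sets.set0) //; apply/seteqP; split.
Qed.

Lemma measurable_rank l t : measurable [set w |
  contents (mis_history adj Q pi w t) != [::] /\
  (l <= rank (mis_history adj Q pi w t)
             (approx_get_min Q w (mis_history adj Q pi w t)))%N]%classic.
Proof.
apply: (measurable_run (F := fun w s => contents (hist s) != [::]
   /\ (l <= rank (hist s) (approx_get_min Q w (hist s)))%N)) => s.
case s0: (contents (hist s) != [::]); last first.
  by rewrite (_ : [set w | _]%classic = classical_sets.set0) //; apply/seteqP; split=> w [].
apply: (measurable_get_min (F := fun x _ => true /\ (l <= rank (hist s) x)%N)) => //.
move=> x; case: (leqP l (rank (hist s) x)) => lx.
  by rewrite (_ : [set w | _]%classic = setT) //; apply/seteqP; split.
by rewrite (_ : [set w | _]%classic = classical_sets.set0) //; apply/seteqP; split=> w [].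
Qed.

Lemma measurable_inversions u j l : measurable [set w | exists t,
  (l <= inversions u j (mis_history adj Q pi w t))%N]%classic.
Proof.
rewrite (_ : [set w | _]%classic =
  (\bigcup_t [set w | (l <= inversions u j (hist (mis_run adj Q pi w t)))%N])%classic).
  apply: bigcupT_measurable => t.
  exact: (measurable_state (fun s => (l <= inversions u j (hist s))%N : Prop)).
by apply/seteqP; split => w /= => [[t lt]|[t _ lt]]; exists t.
Qed.

End Measurability.

Section MeanBound.
Variables (R : realType) (d : measure_display) (Omega : measurableType d).
Variable P : probability Omega R.

(** Bundles measurability, nonnegativity and the bound on the mean, so that it passes through sums
    and scalings. *)
Definition mean_le (g : Omega -> R) (c : R) : Prop :=
  [/\ measurable_fun setT g, forall w, 0 <= g w
    & (\int[P]_w (g w)%:E <= c%:E)%E].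

Lemma mean_le_ind (b : Omega -> bool) c : measurable [set w | b w]%classic ->
  (P [set w | b w]%classic <= c%:E)%E -> mean_le (fun w => (b w)%:R) c.
Proof.
move=> mb bc.
have -> : (fun w => (b w)%:R) = \1_[set w | b w]%classic :> (Omega -> R).
  by apply/funext => w; rewrite indicE; congr (_%:R); apply/esym; rewrite mem_setE.
split; first exact: measurable_indic.
  by move=> w; rewrite indicE.
by rewrite integral_indic // setIT.
Qed.

Lemma mean_le_cst c : 0 <= c -> mean_le (fun=> c) c.
Proof.
move=> c0; split => //.
by rewrite integral_cst //= probability_setT mule1.
Qed.

Lemma mean_leD g1 g2 c1 c2 : mean_le g1 c1 -> mean_le g2 c2 ->
  mean_le (fun w => g1 w + g2 w) (c1 + c2).
Proof.
move=> [m1 p1 i1] [m2 p2 i2]; split; first exact: measurable_funD.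
  by move=> w; apply: addr_ge0.
under eq_integral do rewrite EFinD.
rewrite ge0_integralD //; [|by move=> w _; rewrite lee_fin|exact/measurable_EFinP
  |by move=> w _; rewrite lee_fin|exact/measurable_EFinP].
by rewrite EFinD leeD.
Qed.

Lemma mean_leZ g c a : 0 <= a -> mean_le g c -> mean_le (fun w => a * g w) (a * c).
Proof.
move=> a0 [m p i]; split; first exact: measurable_funM.
  by move=> w; apply: mulr_ge0.
under eq_integral do rewrite EFinM.
rewrite ge0_integralZl //; [|exact/measurable_EFinP|by move=> w _; rewrite lee_fin].
by rewrite EFinM lee_wpmul2l.
Qed.

Lemma mean_le_sum (I : Type) (r : seq I) (S : pred I) (g : I -> Omega -> R) (c : I -> R) :
  (forall i, S i -> mean_le (g i) (c i)) ->
  mean_le (fun w => \sum_(i <- r | S i) g i w) (\sum_(i <- r | S i) c i).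
Proof.
move=> gc; elim: r => [|i r IH].
  under eq_fun do rewrite big_nil.
  by rewrite big_nil; apply: mean_le_cst.
under eq_fun do rewrite big_cons.
rewrite big_cons; case: ifP => // Si; exact: mean_leD (gc _ Si) IH.
Qed.

Lemma mean_le_trans g c c' : c <= c' -> mean_le g c -> mean_le g c'.
Proof. by move=> cc [? ? gc]; split=> //; apply: le_trans gc _; rewrite lee_fin. Qed.

End MeanBound.

(** * Tail bounds *)

Section Tails.
Variable R : realType.

(** Raises 1 + y <= exp y to the power [N] at y = x / (k N). *)
Lemma expR_poly_tail (k x : R) (N : nat) : 0 < k -> 0 < x -> (0 < N)%N ->
  expR (- (x / k)) <= (N%:R * k / x) ^+ N.
Proof.
move=> k0 x0 N0; have N0R : 0 < N%:R :> R by rewrite ltr0n.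
pose y := x / k / N%:R; have y0 : 0 < y by rewrite /y !divr_gt0.
have -> : x / k = N%:R * y by rewrite /y; field; rewrite !gt_eqF.
have -> : N%:R * k / x = y^-1 by rewrite /y; field; rewrite !gt_eqF.
rewrite expRN expRM_natl exprVn lef_pV2 ?posrE ?exprn_gt0 ?expR_gt0 //.
apply: lerXn2r; rewrite ?nnegrE ?expR_ge0 ?(ltW y0) //.
by apply: le_trans (expR_ge1Dx y); rewrite lerDr.
Qed.

(** Turns an excess of a [p]-th power into a threshold [x]. The polynomial tail of degree 2p decays
    like 1 / c^2, which is summable; [1 < x] matches the range of the rank hypothesis. *)
Lemma tail_threshold (p c : nat) (k : R) : (0 < p)%N -> 1 <= k -> (0 < c)%N ->
  exists x : nat, [/\ (1 < x)%N, forall y, (c < y ^ p)%N = (x <= y)%N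
    & expR (- (x%:R / k)) <= (p.*2)%:R ^+ p.*2 * k ^+ p.*2 / c%:R ^+ 2].
Proof.
move=> p0 k1 c0; have k0 : 0 < k by exact: lt_le_trans k1.
have ex : exists x, (c < x ^ p)%N.
  by exists c.+1; apply: (@leq_trans (c.+1 ^ 1)); [rewrite expn1 | rewrite leq_pexp2l].
case: (ex_minnP ex) => x cx xmin.
have x1 : (1 < x)%N.
  rewrite ltnNge; apply/negP => x1; have : (x ^ p <= 1 ^ p)%N by rewrite leq_exp2r.
  by rewrite exp1n; lia.
exists x; split=> //.
  move=> y; apply/idP/idP => [/xmin//|xy]; apply: leq_trans cx _.
  by rewrite leq_exp2r.
have x0 : 0 < x%:R :> R by rewrite ltr0n; lia.
apply: le_trans (expR_poly_tail k0 x0 (_ : 0 < p.*2)%N) _; first by rewrite double_gt0.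
rewrite !exprMn exprVn ler_pM2l ?mulr_gt0 ?exprn_gt0 ?ltr0n ?double_gt0 //.
rewrite lef_pV2 ?posrE ?exprn_gt0 // ?ltr0n //.
by rewrite -muln2 exprM -!natrX ler_nat leq_exp2r // ltnW.
Qed.

Lemma sum_inv_sqr_le n : \sum_(i < n) (i.+1%:R ^+ 2)^-1 <= 2 :> R.
Proof.
suff H : \sum_(i < n.+1) (i.+1%:R ^+ 2)^-1 <= 2 - n.+1%:R^-1 :> R.
  apply: (@le_trans _ _ (\sum_(i < n.+1) (i.+1%:R ^+ 2)^-1)).
    by rewrite big_ord_recr lerDl /= invr_ge0 exprn_ge0.
  by apply: le_trans H _; rewrite gerDl oppr_le0 invr_ge0.
(* Telescoping against 1/a - 1/(a+1). *)
elim: n => [|n IH]; first by rewrite big_ord1 expr1n invr1; lra.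
rewrite big_ord_recr /=; apply: le_trans (lerD IH (lexx _)) _.
have -> : n.+2%:R = n.+1%:R + 1 :> R by rewrite -natr1.
set a := n.+1%:R; have a0 : 0 < a by rewrite ltr0n.
rewrite -subr_ge0.
have -> : 2 - (a + 1)^-1 - (2 - a^-1 + ((a + 1) ^+ 2)^-1) = (a * (a + 1) ^+ 2)^-1.
  by field; rewrite !gt_eqF // addr_gt0.
by rewrite invr_ge0 mulr_ge0 ?sqr_ge0 // ltW.
Qed.

Lemma sum_inj_le (I : finType) (S : pred I) (g : I -> nat) (f : nat -> R) n :
  {in S &, injective g} -> (forall i, S i -> (g i < n)%N) -> (forall j, 0 <= f j) ->
  \sum_(i | S i) f (g i) <= \sum_(j < n) f j.
Proof.
move=> g_inj g_lt f0.
have -> : \sum_(i | S i) f (g i) = \sum_(i | S i) \sum_(j < n | j == g i :> nat) f j.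
  by apply: eq_bigr => i Si; rewrite (big_pred1 (Ordinal (g_lt _ Si))).
rewrite (exchange_big_dep xpredT) //=; apply: ler_sum => j _.
case: (pickP (fun i => S i && (j == g i :> nat))) => [i /andP[Si /eqP ji]|none].
  rewrite (big_pred1 i) // => i' /=; apply/andP/eqP => [[Si' /eqP ji']|-> //].
    by apply: g_inj; rewrite // -ji -ji'.
  by rewrite Si ji eqxx.
by rewrite big_pred0.
Qed.

Lemma sum_inj_inv_sqr_le (I : finType) (S : pred I) (g : I -> nat) :
  {in S &, injective g} -> \sum_(i | S i) ((g i).+1%:R ^+ 2)^-1 <= 2 :> R.
Proof.
move=> g_inj; pose n := (\max_i g i).+1.
apply: le_trans (@sum_inj_le _ _ _ (fun j => (j.+1%:R ^+ 2)^-1) n g_inj _ _) _.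
- by move=> i _; rewrite ltnS; apply: leq_bigmax.
- by move=> j; rewrite invr_ge0 exprn_ge0.
- exact: sum_inv_sqr_le.
Qed.

Lemma sum_gap_le T a : \sum_(t < T) ((gap t a).+1%:R ^+ 2)^-1 <= 4 :> R.
Proof.
rewrite (bigID (fun t : 'I_T => a <= t)%N) /=.
have -> : 4 = 2 + 2 :> R by lra.
apply: lerD; apply: sum_inj_inv_sqr_le => s t; rewrite !unfold_in /gap => sa ta st.
  apply: ord_inj; move: (nat_of_ord s) (nat_of_ord t) sa ta st; lia.
apply: ord_inj; move: (nat_of_ord s) (nat_of_ord t) sa ta st; lia.
Qed.

End Tails.

(** * Expected cost of exceptional ranks and inversion counts *)

Section Excess.
Variables (R : realType) (d : measure_display) (Omega : measurableType d).
Variables (P : probability Omega R) (V : finType) (adj : rel V) (Q : scheduler Omega V).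
Variables (pi : {perm V}) (k : R) (p : nat).
Hypothesis k1 : 1 <= k.
Hypothesis p0 : (0 < p)%N.
Hypothesis relaxed : k_relaxed P Q k (mis_history adj Q pi).

Let C : R := (p.*2)%:R ^+ p.*2 * k ^+ p.*2.

Lemma C_ge0 : 0 <= C.
Proof. by rewrite mulr_ge0 ?exprn_ge0 //; apply: le_trans k1. Qed.

Lemma mean_rank_excess L t m : (0 < L)%N ->
  mean_le P (fun w => (rank_excess adj Q pi w p L t m)%:R)
    (C / L%:R ^+ p.*2 * ((gap t (position pi m)).+1%:R ^+ 2)^-1).
Proof.
move=> L0; set c := (L ^ p * (gap t (position pi m)).+1)%N.
have c0 : (0 < c)%N by rewrite muln_gt0 expn_gt0 L0.
have [x [x1 xP ex]] := tail_threshold p0 k1 c0.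
have E : [set w | rank_excess adj Q pi w p L t m]%classic =
    [set w | contents (mis_history adj Q pi w t) != [::] /\
      (x <= rank (mis_history adj Q pi w t)
             (approx_get_min Q w (mis_history adj Q pi w t)))%N]%classic.
  apply/seteqP; split => w /=; rewrite /rank_excess -/c xP; first by move/andP.
  by move=> H; apply/andP.
apply: mean_le_ind; rewrite E; first exact: measurable_rank.
apply: le_trans (relaxed.1 t x x1) _; rewrite lee_fin; apply: le_trans ex _.
rewrite /C /c natrM natrX exprMn -exprM muln2 invfM mulrA.
exact: lexx.
Qed.

Lemma mean_inversion_excess L T m x j : (0 < L)%N ->
  mean_le P (fun w => (inversion_excess adj Q pi w p L T m x j)%:R)
    (C / L%:R ^+ p.*2 * ((position pi m - position pi x).+1%:R ^+ 2)^-1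
     * (j.+1%:R ^+ 2)^-1).
Proof.
move=> L0; set c := (L ^ p * (position pi m - position pi x).+1 * j.+1)%N.
have c0 : (0 < c)%N by rewrite !muln_gt0 expn_gt0 L0.
have [l [l1 lP el]] := tail_threshold p0 k1 c0.
apply: mean_le_ind.
  exact: (measurable_state adj Q pi (fun s => (c < inversions x j (hist s) ^ p)%N : Prop)).
(* The event at time [T] implies the event at some time, which the hypothesis on [Q] bounds. *)
apply: le_trans (_ : _ <= P [set w | exists t,
  (l <= inversions x j (mis_history adj Q pi w t))%N]%classic)%E _.
  apply: le_measure; rewrite ?inE.
  - exact: (measurable_state adj Q pi (fun s => (c < inversions x j (hist s) ^ p)%N : Prop)).
  - exact: measurable_inversions.
  - by move=> w /=; rewrite /inversion_excess -/c lP => H; exists T.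
apply: le_trans (relaxed.2 x j l (ltnW l1)) _; rewrite lee_fin; apply: le_trans el _.
rewrite /C /c !natrM natrX !exprMn -exprM muln2 !invfM !mulrA.
exact: lexx.
Qed.

(** The factor 8 is 4 from the two-sided sum over times plus 2 * 2 from the sums over vertices and
    stays. *)
Lemma mean_excess L T m : (0 < L)%N ->
  mean_le P (fun w => (\sum_(t < T) rank_excess adj Q pi w p L t m
     + \sum_(x | (position pi x <= position pi m)%N) \sum_(j < T.+2)
         inversion_excess adj Q pi w p L T m x j)%N%:R)
    (8 * (C / L%:R ^+ p.*2)).
Proof.
move=> L0; have D0 : 0 <= C / L%:R ^+ p.*2 by rewrite divr_ge0 ?C_ge0 ?exprn_ge0.
under eq_fun do rewrite natrD !natr_sum.
have -> : 8 * (C / L%:R ^+ p.*2) = C / L%:R ^+ p.*2 * 4 + C / L%:R ^+ p.*2 * 2 * 2 by ring.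
apply: mean_leD.
  apply: mean_le_trans; last by apply: mean_le_sum => t _; apply: mean_rank_excess.
  by rewrite -mulr_sumr ler_wpM2l // sum_gap_le.
under eq_fun do under eq_bigr do rewrite natr_sum.
apply: mean_le_trans; last first.
  by apply: mean_le_sum => x _; apply: mean_le_sum => j _; apply: mean_inversion_excess.
under eq_bigr do rewrite -mulr_sumr.
apply: (@le_trans _ _ (\sum_(x | (position pi x <= position pi m)%N)
  C / L%:R ^+ p.*2 * ((position pi m - position pi x).+1%:R ^+ 2)^-1 * 2)).
  apply: ler_sum => x _; apply: ler_wpM2l; last exact: sum_inv_sqr_le.
  by rewrite mulr_ge0 // invr_ge0 exprn_ge0.
rewrite -mulr_suml -mulr_sumr ler_pM2r // ler_wpM2l //.
apply: sum_inj_inv_sqr_le => x y; rewrite !unfold_in => xm ym xy.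
apply: (@position_inj _ pi); lia.
Qed.

Lemma mean_excess_cost T :
  mean_le P (fun w => (excess_cost adj Q pi w p T)%:R)
    (\sum_m ((window_cost adj pi 1 (position pi m))%:R
      + \sum_(l < #|V| + T) 8 * (C / l.+1%:R ^+ p.*2)
          * (window_cost adj pi l.+2 (position pi m))%:R)).
Proof.
under eq_fun do rewrite natr_sum; apply: mean_le_sum => m _.
under eq_fun do rewrite natrD natr_sum; apply: mean_leD; first exact: mean_le_cst.
apply: mean_le_sum => l _; under eq_fun do rewrite natrM mulrC.
rewrite mulrC; apply: mean_leZ => //; exact: mean_excess.
Qed.

End Excess.

(** * Averaging over the orderings *)

Section Average.
Variables (V : finType) (adj : rel V).

Lemma sum_position (pi : {perm V}) (F : nat -> nat) :
  (\sum_m F (position pi m) = \sum_(i < #|V|) F i)%N.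
Proof.
rewrite (reindex (vertex_at pi)) /=; last first.
  exists (fun v => enum_rank (pi v)) => [c _|v _]; last exact: vertex_at_position.
  by apply: ord_inj; apply: position_vertex_at.
by apply: eq_bigr => c _; rewrite position_vertex_at.
Qed.

Lemma window_size_le L : (0 < L -> (7 * L ^ 6).+1 <= 8 * L ^ 6)%N.
Proof. by move=> L0; rewrite [leqRHS]mulSn -add1n leq_add2r expn_gt0 L0. Qed.

Lemma sum_window_cost L : (0 < L)%N ->
  (\sum_(pi : {perm V}) \sum_m window_cost adj pi L (position pi m)
   <= 64 * L ^ 14 * #|{perm V}|)%N.
Proof.
move=> L0.
have -> : (64 * L ^ 14 * #|{perm V}| = L ^ 2 * ((8 * L ^ 6) ^ 2 * #|{perm V}|))%N by ring.
apply: (@leq_trans (L ^ 2 * ((7 * L ^ 6).+1 ^ 2 * #|{perm V}|))); last first.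
  by rewrite leq_mul2l leq_mul2r leq_exp2r // window_size_le ?orbT.
apply: leq_trans (leq_mul (leqnn _) (sum_live_window1 adj (7 * L ^ 6))).
rewrite big_distrr; apply: leq_sum => pi _ /=.
by rewrite sum_position /window_cost -big_distrr.
Qed.

Lemma sum_window_cost2 L : (0 < L)%N ->
  (\sum_(pi : {perm V}) (\sum_m window_cost adj pi L (position pi m)) ^ 2
   <= 4 * 8 ^ 4 * L ^ 28 * #|{perm V}|)%N.
Proof.
move=> L0.
have -> : (4 * 8 ^ 4 * L ^ 28 * #|{perm V}|
   = L ^ 4 * (4 * (8 * L ^ 6) ^ 4 * #|{perm V}|))%N.
  by rewrite expnMn -expnM; ring.
apply: (@leq_trans (L ^ 4 * (4 * (7 * L ^ 6).+1 ^ 4 * #|{perm V}|))); last first.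
  by rewrite leq_mul2l leq_mul2r leq_mul2l leq_exp2r // window_size_le ?orbT.
apply: leq_trans (leq_mul (leqnn _) (sum_live_window2 adj (7 * L ^ 6))).
rewrite big_distrr; apply: leq_sum => pi _ /=.
by rewrite sum_position /window_cost -big_distrr /= expnMn -expnM.
Qed.

End Average.

(** Two spare powers suffice for a summable term. *)
Lemma exp_ratio_le (R : realFieldType) (i e q : nat) : (e + 2 <= q)%N ->
  i.+1%:R ^+ e / i.+1%:R ^+ q <= (i.+1%:R ^+ 2)^-1 :> R.
Proof.
move=> eq; have i0 j : 0 < i.+1%:R ^+ j :> R by rewrite exprn_gt0 ?ltr0n.
rewrite ler_pdivrMr // mulrC ler_pdivlMr // -exprD.
by apply: ler_weXn2l; [rewrite ler1n | lia].
Qed.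

(** * The mean of the run bound over the orderings *)

Section Expectation.
Variables (R : realType) (V : finType) (adj : rel V).
Variables (k : R) (p : nat).
Hypothesis k1 : 1 <= k.
Hypothesis p_ge : (36 <= p)%N.

Definition slack : R :=
  1 + 2 * 64 + 2 * 2 ^+ p * (4 * 8 ^+ 4 * 2)
  + 2 * (8 * (p.*2)%:R ^+ p.*2 * 64 * 2 ^+ 14 * 2) * k ^+ p.*2.

Definition run_bound (T : nat) (pi : {perm V}) : R :=
  #|V|%:R + (1 + 2 * \sum_m ((window_cost adj pi 1 (position pi m))%:R
      + \sum_(l < #|V| + T) 8 * ((p.*2)%:R ^+ p.*2 * k ^+ p.*2 / l.+1%:R ^+ p.*2)
          * (window_cost adj pi l.+2 (position pi m))%:R)
    + 2 * 2 ^+ p * \sum_(L < T.+3)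
        (\sum_m window_cost adj pi L (position pi m))%N%:R ^+ 2 / L%:R ^+ p).

Lemma sum_run_bound T :
  \sum_(pi : {perm V}) run_bound T pi <= #|{perm V}|%:R * (#|V|%:R + slack).
Proof.
set N := #|{perm V}|; set C := (p.*2)%:R ^+ p.*2 * k ^+ p.*2.
have C0 : 0 <= C by rewrite mulr_ge0 ?exprn_ge0 // (le_trans _ k1).
have first1 L : (0 < L)%N ->
    \sum_(pi : {perm V}) \sum_m (window_cost adj pi L (position pi m))%:R
    <= 64 * L%:R ^+ 14 * N%:R :> R.
  move=> L0; rewrite -natrX -!natrM.
  apply: le_trans (_ : _ <= (\sum_(pi : {perm V})
    \sum_m window_cost adj pi L (position pi m))%N%:R) _.
    by rewrite natr_sum; apply: ler_sum => pi _; rewrite natr_sum.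
  by rewrite ler_nat sum_window_cost.
have excess : \sum_(pi : {perm V}) \sum_m ((window_cost adj pi 1 (position pi m))%:R
      + \sum_(l < #|V| + T) 8 * (C / l.+1%:R ^+ p.*2)
          * (window_cost adj pi l.+2 (position pi m))%:R)
    <= 64 * N%:R + 8 * C * 64 * 2 ^+ 14 * 2 * N%:R.
  under eq_bigr do rewrite big_split /=.
  rewrite big_split /=; apply: lerD.
    by apply: le_trans (first1 1%N isT) _; rewrite expr1n mulr1.
  under eq_bigr do rewrite exchange_big /=.
  rewrite exchange_big /=.
  apply: (@le_trans _ _ (\sum_(l < #|V| + T)
      8 * C * 64 * 2 ^+ 14 * N%:R * (l.+1%:R ^+ 2)^-1)).
    apply: ler_sum => l _; under eq_bigr do rewrite -mulr_sumr.
    rewrite -mulr_sumr.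
    have D0 : 0 <= 8 * (C / l.+1%:R ^+ p.*2) by rewrite mulr_ge0 // divr_ge0 ?exprn_ge0.
    apply: le_trans (ler_wpM2l D0 (first1 l.+2 isT)) _.
    (* The cost sits one level above the failure; l + 2 <= 2 (l + 1) brings both to the same
       base. *)
    have le2 : l.+2%:R ^+ 14 <= 2 ^+ 14 * l.+1%:R ^+ 14 :> R.
      rewrite -exprMn; apply: lerXn2r; rewrite ?nnegrE ?mulr_ge0 //.
      by rewrite -natrM ler_nat; lia.
    have ratio : l.+1%:R ^+ 14 / l.+1%:R ^+ p.*2 <= (l.+1%:R ^+ 2)^-1 :> R.
      by apply: exp_ratio_le; rewrite -addnn; lia.
    have X0 : 0 <= 8 * C * 64 * N%:R by do ![exact: C0 | exact: ler0n | apply: mulr_ge0].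
    have Y0 : 0 <= (l.+1%:R ^+ p.*2)^-1 :> R by rewrite invr_ge0 exprn_ge0.
    have -> : 8 * (C / l.+1%:R ^+ p.*2) * (64 * l.+2%:R ^+ 14 * N%:R)
       = 8 * C * 64 * N%:R * (l.+2%:R ^+ 14 / l.+1%:R ^+ p.*2) by ring.
    have -> : 8 * C * 64 * 2 ^+ 14 * N%:R * (l.+1%:R ^+ 2)^-1
       = 8 * C * 64 * N%:R * (2 ^+ 14 * (l.+1%:R ^+ 2)^-1) by ring.
    apply: ler_wpM2l => //; apply: le_trans (ler_wpM2r Y0 le2) _.
    by rewrite -mulrA ler_pM2l // exprn_gt0.
  rewrite -mulr_sumr; have -> : 8 * C * 64 * 2 ^+ 14 * 2 * N%:R
    = 8 * C * 64 * 2 ^+ 14 * N%:R * 2 by ring.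
  by apply: ler_wpM2l; [do ![exact: C0 | exact: ler0n | apply: exprn_ge0 | apply: mulr_ge0]
    | apply: sum_inv_sqr_le].
have second : \sum_(pi : {perm V}) \sum_(L < T.+3)
      (\sum_m window_cost adj pi L (position pi m))%N%:R ^+ 2 / L%:R ^+ p
    <= 4 * 8 ^+ 4 * 2 * N%:R :> R.
  (* The term L = 0 vanishes, since [window_cost] has the factor L^2. *)
  rewrite exchange_big /= big_ord_recl /= big1 ?add0r; last first.
    by move=> pi _; rewrite big1 ?expr0n ?mul0r.
  apply: (@le_trans _ _ (\sum_(i < T.+2) 4 * 8 ^+ 4 * N%:R * (i.+1%:R ^+ 2)^-1)).
    apply: ler_sum => i _; rewrite /bump add1n -mulr_suml.
    (* The second moment grows like L^28: L^4 from the squared charge and L^24 from the fourth power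
       of the window length. *)
    have ratio : i.+1%:R ^+ 28 / i.+1%:R ^+ p <= (i.+1%:R ^+ 2)^-1 :> R.
      by apply: exp_ratio_le; lia.
    have Y0 : 0 <= (i.+1%:R ^+ p)^-1 :> R by rewrite invr_ge0 exprn_ge0.
    apply: (@le_trans _ _ (4 * 8 ^+ 4 * i.+1%:R ^+ 28 * N%:R / i.+1%:R ^+ p)).
      apply: ler_wpM2r => //; rewrite -!natrX -!natrM.
      under eq_bigr do rewrite -natrX.
      by rewrite -natr_sum ler_nat sum_window_cost2.
    have -> : 4 * 8 ^+ 4 * i.+1%:R ^+ 28 * N%:R / i.+1%:R ^+ p
       = 4 * 8 ^+ 4 * N%:R * (i.+1%:R ^+ 28 / i.+1%:R ^+ p) :> R by ring.
    by apply: ler_wpM2l => //; do ![apply: mulr_ge0 | apply: exprn_ge0 | exact: ler0n].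
  rewrite -mulr_sumr; have -> : 4 * 8 ^+ 4 * 2 * N%:R = 4 * 8 ^+ 4 * N%:R * 2 :> R by ring.
  by apply: ler_wpM2l; [do ![exact: C0 | exact: ler0n | apply: exprn_ge0 | apply: mulr_ge0]
    | apply: sum_inv_sqr_le].
rewrite /run_bound big_split /= sumr_const !big_split /= sumr_const -!mulr_sumr -/C.
rewrite /slack -[#|V|%:R *+ _]mulr_natr -/N.
have p2 : 0 < 2 * 2 ^+ p :> R by rewrite mulr_gt0 ?exprn_gt0.
have -> : N%:R * (#|V|%:R + (1 + 2 * 64 + 2 * 2 ^+ p * (4 * 8 ^+ 4 * 2)
    + 2 * (8 * (p.*2)%:R ^+ p.*2 * 64 * 2 ^+ 14 * 2) * k ^+ p.*2))
  = #|V|%:R * N%:R + (N%:R + 2 * (64 * N%:R + 8 * C * 64 * 2 ^+ 14 * 2 * N%:R)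
     + 2 * 2 ^+ p * (4 * 8 ^+ 4 * 2 * N%:R)) by rewrite /C; ring.
rewrite lerD2l -addrA -[X in _ <= X]addrA lerD2l; apply: lerD.
  by rewrite ler_pM2l.
by rewrite (ler_pM2l p2).
Qed.

End Expectation.

(** * The expected number of iterations *)

Section Total.
Variables (R : realType) (d : measure_display) (Omega : measurableType d).
Variables (P : probability Omega R) (V : finType) (adj : rel V) (Q : scheduler Omega V).
Variables (k : R) (p : nat).
Hypotheses (adj_sym : symmetric adj) (adj_irr : irreflexive adj).
Hypothesis k1 : 1 <= k.
Hypothesis p_ge : (36 <= p)%N.

Let run_ind pi t w : R := (running (mis_run adj Q pi w t))%:R.

Lemma run_ind_mean pi t : mean_le P (run_ind pi t) 1.
Proof.
have mr : measurable [set w | running (mis_run adj Q pi w t)]%classic.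
  exact: (measurable_state adj Q pi (fun s => running s : Prop)).
by apply: mean_le_ind => //; apply: probability_le1.
Qed.

Lemma sum_running_le pi T : k_relaxed P Q k (mis_history adj Q pi) ->
  (\sum_(0 <= t < T) \int[P]_w (run_ind pi t w)%:E <= (run_bound adj k p T pi)%:E)%E.
Proof.
move=> relaxed; have p0 : (0 < p)%N by lia.
pose K : R := 2 * 2 ^+ p * \sum_(L < T.+3)
  (\sum_m window_cost adj pi L (position pi m))%N%:R ^+ 2 / L%:R ^+ p.
have K0 : 0 <= K.
  apply: mulr_ge0; first by rewrite mulr_ge0 ?exprn_ge0.
  by apply: sumr_ge0 => L _; rewrite divr_ge0 ?exprn_ge0.
pose g w : R := #|V|%:R + (1 + 2 * (excess_cost adj Q pi w p T)%:R + K).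
have [mg g0 ig] : mean_le P g (run_bound adj k p T pi).
  apply: mean_leD; first exact: mean_le_cst.
  apply: mean_leD; last exact: mean_le_cst.
  apply: mean_leD; first exact: mean_le_cst.
  by apply: mean_leZ => //; apply: mean_excess_cost.
have mr t : measurable_fun setT (run_ind pi t) by have [] := run_ind_mean pi t.
rewrite -ge0_integral_sum //; first last.
- by move=> t w _; rewrite lee_fin.
- by move=> t; apply/measurable_EFinP.
apply: le_trans ig; apply: ge0_le_integral => //.
- by move=> w _; apply: sume_ge0 => t _; rewrite lee_fin.
- by apply: emeasurable_sum => t; apply/measurable_EFinP.
- exact/measurable_EFinP.
- move=> w _; rewrite sumEFin lee_fin big_mkord -natr_sum.
  exact: running_bound.
Qed.

(** Monotone convergence writes the expectation as a series of probabilities of still running; its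
    partial sums are bounded uniformly in [T], so the limit is finite. *)
Lemma expected_iterations_le :
  (forall pi : {perm V}, k_relaxed P Q k (mis_history adj Q pi)) ->
  (expected_iterations adj Q P <= (#|V|%:R + slack k p)%:E)%E.
Proof.
move=> relaxed; rewrite /expected_iterations; set N := #|{perm V}|.
have N0 : 0 < N%:R :> R by rewrite ltr0n; apply/card_gt0P; exists 1%g.
have r0 pi t : (0 <= \int[P]_w (run_ind pi t w)%:E)%E.
  by apply: integral_ge0 => w _; rewrite lee_fin.
have -> : (\sum_(pi : {perm V}) \int[P]_w iterations adj Q R pi w
    = \sum_(0 <= t <oo) \sum_(pi : {perm V}) \int[P]_w (run_ind pi t w)%:E)%E.
  rewrite nneseries_sum //; apply: eq_bigr => pi _.
  rewrite -integral_nneseries //.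
  - by move=> t; apply/measurable_EFinP; have [] := run_ind_mean pi t.
  - by move=> t w _; rewrite lee_fin.
rewrite lee_pdivrMl //.
apply: lime_le.
  by apply: is_cvg_nneseries => t _ _; apply: sume_ge0.
apply: nearW => T; rewrite exchange_big /=.
apply: le_trans (_ : _ <= \sum_(pi : {perm V}) (run_bound adj k p T pi)%:E)%E _.
  by apply: lee_sum => pi _; apply: sum_running_le.
rewrite sumEFin -EFinM lee_fin.
exact: sum_run_bound.
Qed.

End Total.

Theorem theorem2 (R : realType) :
  exists p : {poly R},
    forall (V : finType) (adj : rel V),
      symmetric adj -> irreflexive adj ->
    forall k : R, 1 <= k ->
    forall (d : measure_display) (Omega : measurableType d)
           (P : probability Omega R) (Q : scheduler Omega V),
      (forall pi : {perm V}, k_relaxed P Q k (mis_history adj Q pi)) ->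
      (expected_iterations adj Q P <= (#|V|%:R + p.[k])%:E)%E.
Proof.
(* [p] is kept abstract so that the powers below are never computed. *)
have [p p_ge] : exists p, (36 <= p)%N by exists 36.
exists ((1 + 2 * 64 + 2 * 2 ^+ p * (4 * 8 ^+ 4 * 2))%:P
  + (2 * (8 * (p.*2)%:R ^+ p.*2 * 64 * 2 ^+ 14 * 2)) *: 'X^(p.*2)).
move=> V adj adj_sym adj_irr k k1 d Omega P Q relaxed.
have := expected_iterations_le adj_sym adj_irr k1 p_ge relaxed.
by rewrite /slack hornerD hornerC hornerZ hornerXn.
Qed.
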